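(* Let $f(x)=\frac1N\sum_{i=1}^N f(x,i)$, $x\in\mathbb{R}^n$, where each $f(\cdot,i):\mathbb{R}^n\to\mathbb{R}$ is continuously differentiable and bounded from below and each $\nabla f(\cdot,i)$ is Lipschitz continuous with parameter $L>0$. Let $\{X^t\}_{t\ge1}$ be the stochastic process generated by the reshuffled proximal point method on the probability space $(\Omega,\mathcal{F},\mathbb{P})$ with step sizes $\alpha_t=\frac{\alpha}{(t+\beta)^\gamma}$, where $\alpha>0$, $\beta\ge0$, $\gamma\in(\frac12,1]$. Assume: (i) $\sup_t\|X^t\|<\infty$ almost surely; (ii) there is an event $\mathcal{K}\in\mathcal{F}$ with $\mathbb{P}(\mathcal{K})=1$ such that $f$ satisfies the KL inequality at every $\bar x\in\bigcup_{\omega\in\mathcal{K}}\mathcal{C}(\omega)$, where each respective desingularizing function can be selected from the class $\mathcal{L}$ of {\L}ojasiewicz functions. Then $\{X^t\}_{t\ge1}$ almost surely converges to a $\mathrm{crit}(f)$-valued random vector $X^*:\Omega\to\mathrm{crit}(f)$. Furthermore, let $\Theta:\Omega\to[0,1)$ denote the function that maps each sample $\omega\in\mathcal{K}$ to the KL exponent of $f$ at $X^*(\omega)$ and let $C:\Omega\to[0,\infty)$ be the associated function of KL constants. Then the event $$\mathcal{H}:=\Big\{\omega\in\Omega:\ \limsup_{t\to\infty}\ t^{\Psi(\omega)}\cdot\|X^t(\omega)-X^*(\omega)\|<\infty\Big\}$$ occurs almost surely, where the rate function $\Psi:\Omega\to[0,\infty)$ is given by $$\Psi(\omega):=\begin{cases}2\gamma-1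 & \text{if } 0\le\Theta(\omega)<\frac{\gamma}{3\gamma-1}\text{ and }\gamma\in(\frac12,1),\\[2pt] \frac{(1-\Theta(\omega))(1-\gamma)}{2\Theta(\omega)-1} & \text{if }\frac{\gamma}{3\gamma-1}\le\Theta(\omega)<1\text{ and }\gamma\in(\frac12,1),\\[2pt] 1 & \text{if }\Theta(\omega)\in[0,\frac12],\ \gamma=1,\text{ and }\alpha>\frac{8C^2(\omega)}{N},\\[2pt] 0 & \text{otherwise.}\end{cases}$$
   Context: Reshuffled proximal point method: given a (deterministic) $x^0\in\mathbb{R}^n$ and step sizes $\alpha_t>0$, at each iteration $t=1,2,\dots$ a permutation $\sigma^t=(\sigma^t_1,\dots,\sigma^t_N)$ of $\{1,\dots,N\}$ is drawn, i.i.d. uniformly over the set $\Lambda$ of all permutations; set $\tilde x^t_0=x^{t-1}$, choose $\tilde x^t_i\in\mathrm{argmin}_{x\in\mathbb{R}^n}\ f(x,\sigma^t_i)+\frac{1}{2\alpha_t}\|x-\tilde x^t_{i-1}\|^2$ for $i=1,\dots,N$, and set $x^t=\tilde x^t_N$. Stochastic model: $\Omega=\Lambda^\infty$ is the set of all sequences $\omega=(\omega_1,\omega_2,\dots)$ with $\omega_i\in\Lambda$, equipped with its natural (product) $\sigma$-algebra $\mathcal{F}$ and the probability $\mathbb{P}$ under which the $\omega_t$ are i.i.d. uniform; $\{X^t(\omega)\}_{t\ge1}$ is the sequence of iterates $x^t$ obtained with $\sigma^t=\omega_t$ (each $X^t$ being a random vector). $\mathcal{C}(\omega)=\{x\in\mathbb{R}^n:\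 \text{there is a subsequence }\{t_\ell\}_\ell\text{ with }X^{t_\ell}(\omega)\to x\}$, and $\mathrm{crit}(f)=\{x\in\mathbb{R}^n:\nabla f(x)=0\}$. The class of {\L}ojasiewicz functions is $\mathcal{L}=\{\varrho:[0,\infty)\to[0,\infty):\ \exists\,c>0,\ \theta\in[0,1)\text{ with }\varrho(s)=cs^{1-\theta}\}$. KL inequality at $\bar x$ with desingularizing function $\varrho(s)=cs^{1-\theta}\in\mathcal{L}$: there are $\eta\in(0,\infty]$ and a neighborhood $U$ of $\bar x$ such that $\varrho'(|f(x)-f(\bar x)|)\cdot\|\nabla f(x)\|\ge1$, i.e. $|f(x)-f(\bar x)|^\theta\le c(1-\theta)\|\nabla f(x)\|$, for all $x\in U$ with $0<|f(x)-f(\bar x)|<\eta$. In this case $\theta$ is called the KL exponent of $f$ at $\bar x$ and $c$ the corresponding KL constant. ''$\mathcal{H}$ occurs almost surely'' means that $\mathcal{H}$ contains some $\mathcal{E}\in\mathcal{F}$ with $\mathbb{P}(\mathcal{E})=1$. The values of $\Theta$ and $C$ on the null set of samples outside $\mathcal{K}$ or where $X^t(\omega)$ does not converge to $X^*(\omega)$ are irrelevant. *)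

(* Defs.v *)
From HB Require Import structures.
From mathcomp Require Import all_boot all_order all_algebra all_fingroup.
From mathcomp Require Import all_classical all_reals all_analysis.

Set Implicit Arguments.
Unset Strict Implicit.
Unset Printing Implicit Defensive.

Import Order.TTheory GRing.Theory Num.Theory.
Import numFieldNormedType.Exports.

Local Open Scope classical_set_scope.
Local Open Scope ring_scope.

(* The norm that MathComp-Analysis puts on ['rV[R]_n] is the sup norm; it
   induces the same topology, but prox steps, Lipschitz and KL constants
   refer to the Euclidean norm. *)
Definition enorm (R : realType) (n : nat) (x : 'rV[R]_n) : R :=
  Num.sqrt (\sum_(j < n) x ord0 j ^+ 2).

Definition grad (R : realType) (n : nat) (f : 'rV[R]_n -> R) (x : 'rV[R]_n) :
    'rV[R]_n :=
  \row_(j < n) 'D_(delta_mx ord0 j) f x.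

Definition crit (R : realType) (n : nat) (f : 'rV[R]_n -> R) :
    set 'rV[R]_n := [set x | grad f x = 0].

Definition continuously_differentiable (R : realType) (n : nat)
    (f : 'rV[R]_n -> R) : Prop :=
  (forall x, differentiable f x) /\ continuous (grad f).

Definition grad_lipschitz (R : realType) (n : nat) (L : R)
    (f : 'rV[R]_n -> R) : Prop :=
  forall x y, enorm (grad f x - grad f y) <= L * enorm (x - y).

Definition average (R : realType) (n N : nat) (f : 'I_N -> 'rV[R]_n -> R)
    (x : 'rV[R]_n) : R := N%:R^-1 * \sum_(i < N) f i x.

Definition argmin (R : realType) (T : Type) (g : T -> R) : set T :=
  [set x | forall y, g x <= g y].

(* Samples are 0-based: the permutation of iteration t >= 1 is [w t.-1]. *)
Definition samples (N : nat) : Type := nat -> 'S_N.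

HB.instance Definition _ (N : nat) := Choice.on (samples N).
HB.instance Definition _ (N : nat) :=
  isPointed.Build (samples N) (fun=> 1%g).

(* [x] is a possible run from [x0] when iteration t >= 1 uses the step size
   [a t] and the permutation [w t.-1]; [y 0], ..., [y N] are the inner
   iterates of iteration [t.+1]. *)
Definition reshuffled_prox (R : realType) (n N : nat)
    (f : 'I_N -> 'rV[R]_n -> R) (a : nat -> R) (x0 : 'rV[R]_n)
    (w : samples N) (x : nat -> 'rV[R]_n) : Prop :=
  x 0%N = x0 /\
  forall t : nat, exists y : nat -> 'rV[R]_n,
    [/\ y 0%N = x t,
        forall i : 'I_N,
          argmin (fun z => f (w t i) z +
                           (2 * a t.+1)^-1 * enorm (z - y i) ^+ 2) (y i.+1)
      & x t.+1 = y N].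

Definition cylinders (N : nat) : set (set (samples N)) :=
  [set B | exists t (A : {set 'S_N}), B = [set w | w t \in A]].

(* [samples N] with the product sigma-algebra. *)
Definition sample_space (N : nat) := g_sigma_algebraType (@cylinders N).

Definition iid_uniform (R : realType) (N : nat)
    (P : probability (sample_space N) R) : Prop :=
  (forall t (s : 'S_N), P [set w | w t = s] = (#|'S_N|%:R^-1)%:E) /\
  (forall (J : seq nat) (A : nat -> {set 'S_N}), uniq J ->
     P [set w | forall t, t \in J -> w t \in A t] =
     (\prod_(t <- J) P [set w | w t \in A t])%E).

Definition almost_surely d (T : measurableType d) (R : realType)
    (P : probability T R) (H : set T) : Prop :=
  exists E : set T, [/\ measurable E, P E = 1%E & E `<=` H].

(* Borel measurability. *)
Definition random_vector d (T : measurableType d) (R : realType) (n : nat)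
    (X : T -> 'rV[R]_n) : Prop :=
  measurable_fun [set: T]
    (X : T -> g_sigma_algebraType (@open 'rV[R]_n)).

Definition accumulation_points (R : realType) (n : nat)
    (x : nat -> 'rV[R]_n) : set 'rV[R]_n :=
  [set z | exists k : nat -> nat,
     {homo k : i j / (i < j)%N} /\ x (k l) @[l --> \oo] --> z].

Definition lojasiewicz (R : realType) (c theta : R) : R -> R :=
  fun s => c * s `^ (1 - theta).

(* KL inequality at [z] with desingularizing function [rho]. *)
Definition KL_inequality (R : realType) (n : nat) (f : 'rV[R]_n -> R)
    (rho : R -> R) (z : 'rV[R]_n) : Prop :=
  exists (eta : \bar R) (U : set 'rV[R]_n),
    [/\ (0 < eta)%E, nbhs z U &
        forall x, U x -> 0 < `|f x - f z| -> (`|f x - f z|%:E < eta)%E ->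
          1 <= derive1 rho `|f x - f z| * enorm (grad f x)].

Definition KL_exponent (R : realType) (n : nat) (f : 'rV[R]_n -> R)
    (z : 'rV[R]_n) (c theta : R) : Prop :=
  [/\ 0 < c, 0 <= theta < 1 & KL_inequality f (lojasiewicz c theta) z].

Definition step_size (R : realType) (alpha beta gamma : R) (t : nat) : R :=
  alpha / (t%:R + beta) `^ gamma.

Definition rate (R : realType) (N : nat) (alpha gamma theta c : R) : R :=
  if [&& 0 <= theta, theta < gamma / (3 * gamma - 1), 2^-1 < gamma
       & gamma < 1]
  then 2 * gamma - 1
  else if [&& gamma / (3 * gamma - 1) <= theta, theta < 1, 2^-1 < gamma
            & gamma < 1]
  then (1 - theta) * (1 - gamma) / (2 * theta - 1)
  else if [&& 0 <= theta, theta <= 2^-1, gamma == 1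
            & 8 * c ^+ 2 / N%:R < alpha]
  then 1
  else 0.

(* Main.v *)
Require Import Defs.
From mathcomp Require Import all_boot all_order all_algebra all_fingroup.
From mathcomp Require Import all_classical all_reals all_analysis.
From mathcomp Require Import ring lra.

(** The argument is pathwise; randomness only enters through the events of
    probability one on which the iterates are bounded and the KL inequality
    holds.  On such a path one epoch is a perturbed gradient step
    [x_t+1 = x_t - N a_t (grad F x_t + O(a_t))], so that, writing [D_t] for
    [enorm (grad F x_t)],
      [F x_t+1 <= F x_t - (N/2) a_t D_t^2 + O(a_t^3)].
    Adding to [F x_t] a multiple [u_t] of [(t + beta)^(1 - 3 gamma)] absorbs the
    cubic error, and [r_t = F x_t + u_t - lim F] decreases to [0].  Near an
    accumulation point the KL inequality, with its exponent raised to
    [nu = max theta (gamma / (3 gamma - 1))], gives [r_t^nu <= O(D_t + a_t)], hence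
      [enorm (x_t+1 - x_t) <= w_t - w_t+1],
      [w_t = A r_t^(1 - nu) + B (t + beta)^(1 - 2 gamma)].
    This potential traps the path near the accumulation point, yields convergence
    and bounds the distance to the limit by [w_t]; the rates then follow from the
    scalar recursion satisfied by [r_t]. *)

Set Implicit Arguments.
Unset Strict Implicit.
Unset Printing Implicit Defensive.

Import Order.TTheory GRing.Theory Num.Theory.
Import numFieldNormedType.Exports.

Local Open Scope classical_set_scope.
Local Open Scope ring_scope.

(** * Real powers and scalar recursions *)

Lemma powR_ge1Dln (R : realType) (x q : R) : 0 < x -> 1 + q * ln x <= x `^ q.
Proof. by move=> x0; rewrite /powR gt_eqF// expR_ge1Dx. Qed.

(** Convexity of [x^(-p)] at [b], obtained without derivatives: bound [(a / b)^(-p)] below by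
    [1 - p * ln (a / b)] and then use [ln x <= x - 1]. *)
Lemma powR_tangent (R : realType) (a b p : R) : 0 < a -> 0 < b -> 0 <= p ->
  b `^ (- p) * (1 - p * (a / b - 1)) <= a `^ (- p).
Proof.
move=> a0 b0 p0; have ab0 : 0 < a / b by rewrite divr_gt0.
rewrite -[in leRHS](divfK (lt0r_neq0 b0) a) powRM ?(ltW ab0) ?(ltW b0)// mulrC.
rewrite ler_wpM2r ?powR_ge0//; apply: le_trans (powR_ge1Dln _ ab0).
have := @le_ln1Dx R (a / b - 1); rewrite subrKC => lnab.
by rewrite mulNr lerD2l lerN2 ler_wpM2l// lnab//; lra.
Qed.

(** The discrete form of integral comparison: it lets powers of the step size be dominated by
    telescoping differences instead of by sums of series. *)
Lemma powR_diff_ge (R : realType) (s p : R) : 0 < s -> 0 <= p ->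
  p * (s + 1) `^ (- (p + 1)) <= s `^ (- p) - (s + 1) `^ (- p).
Proof.
move=> s0 p0; have s10 : 0 < s + 1 by lra.
have := powR_tangent s0 s10 p0.
rewrite opprD powRD ?(gt_eqF s10) ?implybT// powR_inv1 ?(ltW s10)//.
have -> : s / (s + 1) - 1 = - (s + 1)^-1 by field; rewrite gt_eqF.
by set e := (_ `^ _) => h; nra.
Qed.

Lemma powR_diff_le (R : realType) (s p : R) : 0 < s -> 0 <= p ->
  s `^ (- p) - (s + 1) `^ (- p) <= p * s `^ (- (p + 1)).
Proof.
move=> s0 p0; have s10 : 0 < s + 1 by lra.
have := powR_tangent s10 s0 p0.
rewrite opprD powRD ?(gt_eqF s0) ?implybT// powR_inv1 ?(ltW s0)//.
have -> : (s + 1) / s - 1 = s^-1 by field; rewrite gt_eqF.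
by set e := (s `^ _) => h; nra.
Qed.

(** Concavity of the desingularizing power: the tangent at [r] lies above the graph. After scaling
    by [r] it becomes Bernoulli's inequality for [x = r' / r]. *)
Lemma powR_concave (R : realType) (r r' p : R) : 0 < r -> 0 <= r' -> 0 < p < 1 ->
  r `^ (p - 1) * (r - r') <= (r `^ p - r' `^ p) / p.
Proof.
move=> r0 r'0 /andP[p0 p1].
rewrite ler_pdivlMr//.
have -> : r `^ p = r * r `^ (p - 1) by rewrite mulr_powRB1// ltW.
have [->|r'n0] := eqVneq r' 0.
  rewrite powR0 ?gt_eqF// !subr0 -mulrA.
  have := mulr_ge0 (ltW r0) (powR_ge0 r (p - 1)); nra.
have {r'0}r'0 : 0 < r' by rewrite lt_def r'n0.
set x := r' / r; have x0 : 0 < x by rewrite divr_gt0.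
have r'E : r' = x * r by rewrite /x divfK ?gt_eqF.
have key : x `^ p <= 1 + p * (x - 1).
  (* With weights [p] and [1 - p] the logarithms in [e1] and [e2] cancel, leaving
     [1 <= p x^(1-p) + (1-p) x^(-p)], to be multiplied by [x^p]. *)
  have e1 := powR_ge1Dln (1 - p) x0; have e2 := powR_ge1Dln (- p) x0.
  have -> : 1 + p * (x - 1) = (p * x `^ (1 - p) + (1 - p) * x `^ (- p)) * x `^ p.
    rewrite mulrDl -!mulrA -!powRD ?(gt_eqF x0) ?implybT//.
    by rewrite subrK addNr powRr0 powRr1 ?ltW//; ring.
  rewrite -[leLHS]mul1r ler_wpM2r ?powR_ge0//; nra.
have -> : r' `^ p = x `^ p * (r * r `^ (p - 1)).
  by rewrite mulr_powRB1 ?ltW// r'E powRM ?ltW.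
have := ler_wpM2r (mulr_ge0 (ltW r0) (powR_ge0 r (p - 1))) key.
rewrite [in X in X -> _]mulrDl r'E; set e := (r `^ _); nra.
Qed.

Lemma ler_powRDD (R : realType) (x y p : R) : 0 <= x -> 0 <= y -> 0 <= p <= 1 ->
  (x + y) `^ p <= 2 * (x `^ p + y `^ p).
Proof.
move=> x0 y0 /andP[p0 p1].
have key (a b : R) : 0 <= a -> a <= b -> (a + b) `^ p <= 2 * b `^ p.
  move=> a0 ab; apply: (@le_trans _ _ ((2 * b) `^ p)).
    by apply: ge0_ler_powR; rewrite ?nnegrE; lra.
  rewrite powRM//; last lra.
  by rewrite ler_wpM2r ?powR_ge0//; apply: ler1_powR; lra.
have := powR_ge0 x p; have := powR_ge0 y p.
have [xy|/ltW yx] := leP x y; first by have := key _ _ x0 xy; lra.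
by have := key _ _ y0 yx; rewrite (addrC y); lra.
Qed.

(* The elementary inequality [D^2 / (kappa D + q) >= D / kappa - q / kappa^2]
   turns the gradient term of the sufficient decrease into a telescoping one. *)
Lemma desingularized_decrease (R : realType) (r r' D h kappa q p : R) :
  0 <= r' -> 0 <= D -> 0 <= h -> 0 < kappa -> 0 <= q -> 0 < p < 1 ->
  h * D ^+ 2 <= r - r' -> r `^ (1 - p) <= kappa * D + q ->
  h * D <= kappa * ((r `^ p - r' `^ p) / p) + h * q / kappa.
Proof.
move=> r'0 D0 h0 k0 q0 p01 dec kl.
have hD2 : 0 <= h * D ^+ 2 by rewrite mulr_ge0// sqr_ge0.
have hq0 : 0 <= h * q / kappa by rewrite divr_ge0 ?mulr_ge0// ltW.
have [/eqP r0|] := boolP (r == 0).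
  have r'E : r' = 0 by lra.
  have /eqP : h * D ^+ 2 = 0 by lra.
  rewrite mulf_eq0 expf_eq0/= => hD; have -> : h * D = 0.
    by apply/eqP; rewrite mulf_eq0.
  by rewrite r0 r'E subrr mul0r mulr0 add0r.
move=> rn0; have {rn0}r0 : 0 < r by rewrite lt_def rn0/=; lra.
have := powR_concave r0 r'0 p01; set psi := (_ / p) => conc.
have e0 : 0 < r `^ (1 - p) by rewrite powR_gt0.
have e1 : r `^ (p - 1) * r `^ (1 - p) = 1.
  by rewrite -powRD ?(gt_eqF r0) ?implybT// addrA subrK subrr powRr0.
have psi0 : 0 <= psi.
  by apply: le_trans conc; rewrite mulr_ge0 ?powR_ge0//; lra.
(* For small [D] the error term alone suffices; otherwise [D], and with it [kappa * D + q], is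
   positive and the inequality can be cleared of denominators. *)
have [Dq|Dq] := leP D (q / kappa).
  have : h * D <= h * (q / kappa) by rewrite ler_wpM2l.
  by have := mulr_ge0 (ltW k0) psi0; lra.
have h1 : h * D ^+ 2 <= psi * r `^ (1 - p).
  apply: le_trans dec _.
  have -> : r - r' = r `^ (p - 1) * (r - r') * r `^ (1 - p).
    by rewrite mulrAC e1 mul1r.
  by rewrite ler_wpM2r ?(ltW e0).
have h2 : h * D ^+ 2 <= psi * (kappa * D + q).
  by apply: le_trans h1 _; rewrite ler_wpM2l.
have kD : 0 < kappa * D + q.
  by rewrite ltr_wpDr// mulr_gt0// (le_lt_trans _ Dq)// divr_ge0// ltW.
rewrite -(ler_pM2r kD); apply: (@le_trans _ _ (kappa * (h * D ^+ 2) + h * D * q)).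
  by rewrite le_eqVlt; apply/orP; left; apply/eqP; ring.
have -> : (kappa * psi + h * q / kappa) * (kappa * D + q) =
    kappa * (psi * (kappa * D + q)) + h * D * q + h * (q ^+ 2 / kappa).
  by field; rewrite gt_eqF.
have : 0 <= h * (q ^+ 2 / kappa) by rewrite mulr_ge0// divr_ge0 ?sqr_ge0// ltW.
by have := ler_wpM2l (ltW k0) h2; lra.
Qed.

(** Induction step of [power_rate], by a dichotomy on [x]. A small [x] leaves half of the target
    free for the error. A large [x] makes the [x^e] term at least [(p + 1) Q s^(-(p+1))], which pays
    [p] units for the decay of the target and one unit for the error. *)
Lemma power_rate_step (R : realType) (s x y gamma e p c M Q : R) :
  1 <= s -> 0 <= x -> 0 <= gamma -> 1 < e -> 0 <= p -> 0 < c -> 0 <= M ->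
  gamma + e * p <= p + 1 -> p + 1 <= 3 * gamma ->
  0 < Q -> 2 * M <= Q ->
  (p + 1) * Q <= c * 2 `^ (- gamma) * (2 `^ (- p) / 2) `^ e * Q `^ e ->
  x <= Q * s `^ (- p) ->
  y <= x - c * (s + 1) `^ (- gamma) * x `^ e + M * (s + 1) `^ (- (3 * gamma)) ->
  y <= Q * (s + 1) `^ (- p).
Proof.
move=> s1 x0 g0 e1 p0 c0 M0 hgp hp3 Qp QM.
have [s0 s10 s20] : [/\ 0 < s, 0 < s + 1 & 0 < 2 * s] by split; lra.
have s12 : s + 1 <= 2 * s by lra.
have ss1 : s <= s + 1 by lra.
have [e0 p10] : 0 <= e /\ 0 <= p + 1 by split; lra.
have [MQ MQ2] : M <= Q /\ M <= Q / 2 by split; lra.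
have pg : - (p + 1) <= - gamma + - p * e by lra.
have pp : - (p + 1) <= - p by lra.
have pg3 : - (3 * gamma) <= - (p + 1) by rewrite lerN2.
have s11 : 1 <= s + 1 by lra.
(* The threshold [Q K s^(-p)] equals half of the target evaluated at [2 s], hence is at most half of
   the target at [s + 1]. *)
have [K KE K0] : exists2 K : R, K = 2 `^ (- p) / 2 & 0 < K.
  by eexists; first reflexivity; rewrite divr_gt0// powR_gt0.
rewrite -KE => kQ IH rec; apply: le_trans rec _.
have e3 : (s + 1) `^ (- (3 * gamma)) <= (s + 1) `^ (- (p + 1)).
  exact: ler_powR.
have half (a : R) : 0 <= a -> (2 * s) `^ (- a) <= (s + 1) `^ (- a).
  move=> a0; rewrite !powRN lef_pV2 ?posrE ?powR_gt0//.
  by apply: ge0_ler_powR; rewrite // nnegrE ltW.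
have [xs|xs] := leP x (Q * K * s `^ (- p)).
  have h1 : Q * K * s `^ (- p) <= Q / 2 * (s + 1) `^ (- p).
    have -> : Q * K * s `^ (- p) = Q / 2 * (2 * s) `^ (- p).
      by rewrite powRM ?(ltW s0)// KE; field.
    by rewrite ler_wpM2l ?half// divr_ge0// ltW.
  have h2 : 0 <= c * (s + 1) `^ (- gamma) * x `^ e.
    by rewrite !mulr_ge0 ?powR_ge0// ltW.
  have h3 : M * (s + 1) `^ (- (3 * gamma)) <= M * (s + 1) `^ (- p).
    by rewrite ler_wpM2l// (le_trans e3)//; exact: ler_powR.
  have h4 : M * (s + 1) `^ (- p) <= Q / 2 * (s + 1) `^ (- p).
    by rewrite ler_wpM2r ?powR_ge0.
  by move: h1 h2 h3 h4; clear - xs; lra.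
have x1 : (Q * K * s `^ (- p)) `^ e <= x `^ e.
  apply: ge0_ler_powR; rewrite ?nnegrE ?(ltW xs)//.
  by rewrite !mulr_ge0 ?powR_ge0// ltW.
have h1 : c * 2 `^ (- gamma) * K `^ e * Q `^ e * s `^ (- (p + 1)) <=
    c * (s + 1) `^ (- gamma) * x `^ e.
  apply: (@le_trans _ _ (c * (2 * s) `^ (- gamma) * (Q * K * s `^ (- p)) `^ e)).
    rewrite !powRM ?mulr_ge0 ?powR_ge0 ?(ltW s0) ?(ltW Qp) ?(ltW K0)// -powRrM.
    have : s `^ (- (p + 1)) <= s `^ (- gamma) * s `^ (- p * e).
      by rewrite -powRD ?(gt_eqF s0) ?implybT//; exact: ler_powR.
    have h0 : 0 <= c * 2 `^ (- gamma) * (Q `^ e * K `^ e).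
      by rewrite !mulr_ge0 ?powR_ge0// ltW.
    by move=> /(ler_wpM2l h0); clear; lra.
  by rewrite ler_pM// ?mulr_ge0 ?powR_ge0 ?(ltW c0)// ler_wpM2l ?half// ltW.
have e5 : (s + 1) `^ (- (p + 1)) <= s `^ (- (p + 1)).
  rewrite !powRN lef_pV2 ?posrE ?powR_gt0//.
  by apply: ge0_ler_powR; rewrite // nnegrE ltW.
have h2 := ler_wpM2l (ltW Qp) (powR_diff_le s0 p0).
have h3 := ler_wpM2l M0 (le_trans e3 e5).
have h4 := ler_wpM2r (powR_ge0 s (- (p + 1))) kQ.
have h6 : M * s `^ (- (p + 1)) <= Q * s `^ (- (p + 1)).
  by rewrite ler_wpM2r ?powR_ge0.
by move: IH h1 h2 h3 h4 h6; clear; lra.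
Qed.

Lemma power_rate (R : realType) (r : nat -> R) (beta gamma e p c M : R) (T : nat) :
  (0 < T)%N -> 0 <= beta -> 0 <= gamma -> 1 < e -> 0 <= p -> 0 < c -> 0 <= M ->
  gamma + e * p <= p + 1 -> p + 1 <= 3 * gamma ->
  (forall t, (T <= t)%N -> 0 <= r t) ->
  (forall t, (T <= t)%N -> r t.+1 <= r t
     - c * (t.+1%:R + beta) `^ (- gamma) * r t `^ e
     + M * (t.+1%:R + beta) `^ (- (3 * gamma))) ->
  exists2 Q, 0 <= Q & forall t, (T <= t)%N -> r t <= Q * (t%:R + beta) `^ (- p).
Proof.
move=> T0 b0 g0 e1 p0 c0 M0 hgp hp3 r0 rec.
pose k := c * 2 `^ (- gamma) * (2 `^ (- p) / 2) `^ e.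
have k0 : 0 < k by rewrite /k !mulr_gt0// powR_gt0// divr_gt0// powR_gt0.
(* [Q0] solves [k Q0^(e-1) = p + 1], which suffices for [kQ] because [e > 1]. In [Q], the term
   [2 * M] dominates the error, the last term starts the induction at [T], and [1] ensures
   positivity. *)
pose Q0 := ((p + 1) / k) `^ (e - 1)^-1.
pose Q := 1 + Q0 + 2 * M + r T * (T%:R + beta) `^ p.
have Q00 : 0 <= Q0 by exact: powR_ge0.
have Q1 : 0 <= r T * (T%:R + beta) `^ p by rewrite mulr_ge0 ?powR_ge0// r0.
have Qp : 0 < Q by rewrite /Q; lra.
have kQ : (p + 1) * Q <= k * Q `^ e.
  have -> : Q `^ e = Q * Q `^ (e - 1) by rewrite mulr_powRB1 ?ltW//; lra.
  have : (p + 1) / k <= Q `^ (e - 1).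
    have <- : Q0 `^ (e - 1) = (p + 1) / k.
      rewrite -powRrM mulVf ?powRr1 ?divr_ge0 ?(ltW k0)//; first lra.
      by rewrite gt_eqF//; lra.
    by apply: ge0_ler_powR; rewrite ?nnegrE /Q; lra.
  by rewrite ler_pdivrMr// => /(ler_wpM2r (ltW Qp)); clear; lra.
exists Q; first exact: ltW.
move=> t; elim: t => [|t IH]; first by rewrite leqn0 => /eqP TE; rewrite TE in T0.
rewrite leq_eqVlt => /predU1P[<-|].
  rewrite powRN ler_pdivlMr ?powR_gt0//; first by rewrite /Q; lra.
  by rewrite ltr_wpDr// ltr0n.
rewrite ltnS => Tt; have {}IH := IH Tt; have {}rec := rec t Tt.
have s1 : 1 <= t%:R + beta by rewrite ler_wpDr// ler1n (leq_trans T0 Tt).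
move: rec; have -> : t.+1%:R + beta = (t%:R + beta) + 1 by rewrite -natr1; lra.
apply: (@power_rate_step _ _ (r t)) => //; first exact: r0.
by rewrite /Q; lra.
Qed.

(** The factor [1 - 4 / (s + 1)] contracts faster than [s^(-2)] decays; the surplus, of order
    [Q / s^3], absorbs the perturbation once [Q >= 2 U]. *)
Lemma inverse_square_rate (R : realType) (r : nat -> R) (beta U : R) (T : nat) :
  (3 <= T)%N -> 0 <= beta -> 0 <= U -> (forall t, (T <= t)%N -> 0 <= r t) ->
  (forall t, (T <= t)%N -> r t.+1 <= r t
     - 4 / (t.+1%:R + beta) * (r t - U / (t%:R + beta) ^+ 2)) ->
  exists2 Q, 0 <= Q & forall t, (T <= t)%N -> r t <= Q / (t%:R + beta) ^+ 2.
Proof.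
move=> T3 b0 U0 r0 rec.
pose Q := 2 * U + r T * (T%:R + beta) ^+ 2.
have Q1 : 0 <= r T * (T%:R + beta) ^+ 2 by rewrite mulr_ge0 ?sqr_ge0// r0.
have Q0 : 0 <= Q by rewrite /Q; lra.
exists Q => // t; elim: t => [|t IH].
  by rewrite leqn0 => /eqP TE; rewrite TE in T3.
rewrite leq_eqVlt => /predU1P[<-|].
  rewrite ler_pdivlMr; first by rewrite /Q; lra.
  by rewrite exprn_gt0// ltr_wpDr// ltr0n (leq_trans _ T3).
rewrite ltnS => Tt; have {}IH := IH Tt; have {}rec := rec t Tt.
(* This makes [1 - 4 / (s + 1)] nonnegative, so the induction hypothesis may be multiplied by it. *)
have s3 : 3 <= t%:R + beta by rewrite ler_wpDr// ler_nat (leq_trans T3 Tt).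
move: rec; have -> : t.+1%:R + beta = (t%:R + beta) + 1 by rewrite -natr1; lra.
move: IH; set s := _ + beta in s3 *; move: (r t) (r t.+1) (r0 t Tt) => x y x0 IH rec.
apply: le_trans rec _.
have s10 : 0 < s + 1 by lra.
have s0 : 0 < s by lra.
have h1 : x * (1 - 4 / (s + 1)) <= Q / s ^+ 2 * (1 - 4 / (s + 1)).
  by rewrite ler_wpM2r// subr_ge0 ler_pdivrMr; lra.
have : Q / (s + 1) ^+ 2 - (Q / s ^+ 2 * (1 - 4 / (s + 1)) + 4 / (s + 1) * (U / s ^+ 2))
   = (Q * (2 * s + 3) - 4 * U * (s + 1)) / (s ^+ 2 * (s + 1) ^+ 2).
  by field; rewrite !gt_eqF.
have : 0 <= (Q * (2 * s + 3) - 4 * U * (s + 1)) / (s ^+ 2 * (s + 1) ^+ 2).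
  apply: divr_ge0; last by rewrite mulr_ge0 ?sqr_ge0.
  have : 2 * U * (2 * s + 3) <= Q * (2 * s + 3) by rewrite ler_wpM2r /Q; lra.
  by nra.
by lra.
Qed.

(** * Euclidean geometry, gradients and the proximal step *)

Definition dot (R : realType) (n : nat) (x y : 'rV[R]_n) : R :=
  \sum_(j < n) x ord0 j * y ord0 j.

Lemma dotC (R : realType) (n : nat) (x y : 'rV[R]_n) : dot x y = dot y x.
Proof. by apply: eq_bigr => j _; rewrite mulrC. Qed.

Lemma dotDr (R : realType) (n : nat) (x y z : 'rV[R]_n) :
  dot x (y + z) = dot x y + dot x z.
Proof. by rewrite -big_split; apply: eq_bigr => j _; rewrite mxE mulrDr. Qed.

Lemma dotZr (R : realType) (n : nat) (a : R) (x y : 'rV[R]_n) :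
  dot x (a *: y) = a * dot x y.
Proof. by rewrite mulr_sumr; apply: eq_bigr => j _; rewrite mxE mulrCA. Qed.

Lemma enorm_ge0 (R : realType) (n : nat) (x : 'rV[R]_n) : 0 <= enorm x.
Proof. exact: sqrtr_ge0. Qed.

Lemma enorm_sqr (R : realType) (n : nat) (x : 'rV[R]_n) : enorm x ^+ 2 = dot x x.
Proof.
rewrite sqr_sqrtr; last by apply: sumr_ge0 => j _; exact: sqr_ge0.
by apply: eq_bigr => j _; rewrite expr2.
Qed.

Lemma enormD_sqr (R : realType) (n : nat) (x y : 'rV[R]_n) :
  enorm (x + y) ^+ 2 = enorm x ^+ 2 + 2 * dot x y + enorm y ^+ 2.
Proof. by rewrite !enorm_sqr dotDr !(dotC (x + y)) !dotDr (dotC y x); ring. Qed.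

Lemma enormZ (R : realType) (n : nat) (a : R) (x : 'rV[R]_n) :
  enorm (a *: x) = `|a| * enorm x.
Proof.
apply/eqP; rewrite -(@eqrXn2 _ 2) ?enorm_ge0 ?mulr_ge0 ?enorm_ge0//; apply/eqP.
by rewrite exprMn !enorm_sqr dotZr dotC dotZr real_normK ?num_real//; ring.
Qed.

Lemma enormN (R : realType) (n : nat) (x : 'rV[R]_n) : enorm (- x) = enorm x.
Proof. by rewrite -scaleN1r enormZ normrN1 mul1r. Qed.

Lemma enorm_distC (R : realType) (n : nat) (x y : 'rV[R]_n) :
  enorm (x - y) = enorm (y - x).
Proof. by rewrite -opprB enormN. Qed.

Lemma ler_coord_enorm (R : realType) (n : nat) (x : 'rV[R]_n) (j : 'I_n) :
  `|x ord0 j| <= enorm x.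
Proof.
rewrite -sqrtr_sqr ler_wsqrtr//.
rewrite (bigD1 j)//= lerDl; apply: sumr_ge0 => i _; exact: sqr_ge0.
Qed.

Lemma enorm_eq0 (R : realType) (n : nat) (x : 'rV[R]_n) : enorm x = 0 -> x = 0.
Proof.
move=> x0; apply/rowP => j; rewrite mxE.
by apply/eqP; rewrite -normr_le0 -x0 ler_coord_enorm.
Qed.

Lemma enorm0 (R : realType) (n : nat) : enorm (0 : 'rV[R]_n) = 0.
Proof. by rewrite -(scale0r (0 : 'rV[R]_n)) enormZ normr0 mul0r. Qed.

Lemma cauchy_schwarz (R : realType) (n : nat) (x y : 'rV[R]_n) :
  dot x y <= enorm x * enorm y.
Proof.
have [x0|x0] := eqVneq (enorm x) 0.
  by rewrite x0 (enorm_eq0 x0) dotC -(scale0r (0 : 'rV[R]_n)) dotZr !mul0r.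
have [y0|y0] := eqVneq (enorm y) 0.
  by rewrite y0 (enorm_eq0 y0) -(scale0r (0 : 'rV[R]_n)) dotZr mulr0 mul0r.
have xp : 0 < enorm x by rewrite lt_def x0 enorm_ge0.
have yp : 0 < enorm y by rewrite lt_def y0 enorm_ge0.
have := sqr_ge0 (enorm (enorm y *: x + - enorm x *: y)).
rewrite enormD_sqr !enormZ normrN !(ger0_norm (enorm_ge0 _)).
rewrite dotZr dotC dotZr (dotC y).
have -> : (enorm y * enorm x) ^+ 2 + 2 * (- enorm x * (enorm y * dot x y)) +
   (enorm x * enorm y) ^+ 2 = 2 * (enorm x * enorm y) * (enorm x * enorm y - dot x y).
  by ring.
by rewrite pmulr_rge0 ?subr_ge0// !mulr_gt0.
Qed.

Lemma ler_enormD (R : realType) (n : nat) (x y : 'rV[R]_n) :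
  enorm (x + y) <= enorm x + enorm y.
Proof.
rewrite -(@ler_pXn2r _ 2) ?nnegrE ?addr_ge0 ?enorm_ge0// enormD_sqr.
by have := cauchy_schwarz x y; rewrite sqrrD -mulr_natl; lra.
Qed.

Lemma ler_enormB (R : realType) (n : nat) (x y z : 'rV[R]_n) :
  enorm (x - z) <= enorm (x - y) + enorm (y - z).
Proof. by apply: le_trans (ler_enormD _ _); rewrite addrA subrK. Qed.

Lemma ler_enorm_sum (R : realType) (n : nat) (I : Type) (s : seq I)
    (F : I -> 'rV[R]_n) :
  enorm (\sum_(i <- s) F i) <= \sum_(i <- s) enorm (F i).
Proof.
elim/big_ind2 : _ => [|x a y b xa yb|//]; first by rewrite enorm0.
by apply: le_trans (ler_enormD _ _) _; exact: lerD.
Qed.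

Lemma ler_norm_enorm (R : realType) (n : nat) (x : 'rV[R]_n) : `|x| <= enorm x.
Proof.
rewrite [leLHS]mx_normrE; apply/bigmax_leP; split; first exact: enorm_ge0.
by move=> [i j] _ /=; rewrite ord1; exact: ler_coord_enorm.
Qed.

Lemma enorm_le_norm (R : realType) (n : nat) (x : 'rV[R]_n) :
  enorm x <= n%:R * `|x|.
Proof.
have h j : `|x ord0 j| <= `|x|.
  by rewrite [leRHS]mx_normrE; apply/bigmax_geP; right; exists (ord0, j).
rewrite {1}(row_sum_delta x); apply: le_trans (ler_enorm_sum _ _) _.
rewrite -[n in n%:R]card_ord mulr_natl -sumr_const; apply: ler_sum => j _.
rewrite enormZ; apply: le_trans (h j); rewrite ler_piMr//.
rewrite -(@ler_pXn2r _ 2) ?nnegrE ?enorm_ge0// enorm_sqr /dot expr1n.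
rewrite (bigD1 j)//= big1 ?addr0 ?mxE ?eqxx ?mulr1//.
by move=> i ij; rewrite mxE (negPf ij) andbF mulr0.
Qed.

Lemma cvg_enormP (R : realType) (n : nat) (x : nat -> 'rV[R]_n) (z : 'rV[R]_n) :
  x t @[t --> \oo] --> z <->
  forall e, 0 < e -> exists T, forall t, (T <= t)%N -> enorm (x t - z) < e.
Proof.
split=> [/cvgrPdist_lt xz e e0|xz].
  have n0 : 0 < n%:R + 1 :> R by rewrite ltr_wpDl.
  have [T _ h] := xz _ (divr_gt0 e0 n0).
  exists T => t /h /=; rewrite ltr_pdivlMr// distrC => xt.
  apply: le_lt_trans (enorm_le_norm _) _; apply: le_lt_trans xt.
  by rewrite mulrC ler_wpM2l// lerDl.
by apply/cvgrPdist_lt => e e0; have [T h] := xz _ e0; exists T => // t /h xt;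
  rewrite /= distrC; apply: le_lt_trans (ler_norm_enorm _) xt.
Qed.

Lemma nbhs_enorm (R : realType) (n : nat) (U : set 'rV[R]_n) (z : 'rV[R]_n) :
  nbhs z U -> exists2 e, 0 < e & forall x, enorm (x - z) < e -> U x.
Proof.
move=> /nbhs_ballP[e /= e0 zU]; exists e => // x xz; apply: zU.
by rewrite -ball_normE /= distrC; apply: le_lt_trans (ler_norm_enorm _) xz.
Qed.

Lemma is_derive_dot_grad (R : realType) (n : nat) (f : 'rV[R]_n -> R)
    (x v : 'rV[R]_n) :
  differentiable f x -> is_derive x v f (dot (grad f x) v).
Proof.
move=> df; apply: DeriveDef; first exact: diff_derivable.
rewrite deriveE// [v in LHS]row_sum_delta linear_sum; apply: eq_bigr => j _.
by rewrite linearZ mxE /= deriveE// mulrC.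
Qed.

Lemma is_derive_line (R : realType) (n : nat) (f : 'rV[R]_n -> R)
    (x v : 'rV[R]_n) (s : R) :
  differentiable f (x + s *: v) ->
  is_derive s 1 (fun s : R => f (x + s *: v)) (dot (grad f (x + s *: v)) v).
Proof.
move=> df.
have h : differentiable (fun s : R => x + s *: v) s by exact: differentiableD.
have fh : differentiable (f \o (fun s : R => x + s *: v)) s.
  exact: differentiable_comp.
apply: DeriveDef; first exact: diff_derivable.
rewrite deriveE// diff_comp//=.
have <- : 'D_v f (x + s *: v) = dot (grad f (x + s *: v)) v.
  by have /@derive_val := is_derive_dot_grad v df.
rewrite deriveE//; congr ('d _ _ _); rewrite -deriveE//.
rewrite deriveD//; last exact: diff_derivable.
by rewrite derive_cst add0r deriveE// diff_val scale1r.
Qed.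

Lemma mvt_grad (R : realType) (n : nat) (f : 'rV[R]_n -> R) (x v : 'rV[R]_n) :
  (forall y, differentiable f y) ->
  exists2 c, 0 <= c <= 1 & f (x + v) - f x = dot (grad f (x + c *: v)) v.
Proof.
move=> df; pose g (s : R) := f (x + s *: v).
have dg (s : R) : is_derive s 1 g (dot (grad f (x + s *: v)) v).
  exact: is_derive_line.
have [|c c01] := @MVT_segment R g (fun s => dot (grad f (x + s *: v)) v) 0 1
  ler01 (fun s _ => dg s).
  apply: continuous_subspaceT => s; apply: differentiable_continuous.
  by apply/derivable1_diffP; have [] := dg s.
rewrite /g scale1r scale0r addr0 subr0 mulr1 => ->; by exists c.
Qed.

(** The mean value theorem on the segment takes the place of the usual integral, which costs the
    constant [L] instead of [L / 2]. *)
Lemma descent_lemma (R : realType) (n : nat) (f : 'rV[R]_n -> R) (L : R)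
    (x v : 'rV[R]_n) :
  0 <= L -> (forall y, differentiable f y) -> grad_lipschitz L f ->
  f (x + v) <= f x + dot (grad f x) v + L * enorm v ^+ 2.
Proof.
move=> L0 df lip; have [c /andP[c0 c1] /eqP] := mvt_grad x v df.
rewrite subr_eq => /eqP->; rewrite addrC -addrA lerD2l.
have -> : grad f (x + c *: v) = grad f x + (grad f (x + c *: v) - grad f x).
  by rewrite subrKC.
rewrite dotC dotDr (dotC v) lerD2l; apply: le_trans (cauchy_schwarz _ _) _.
have := lip (x + c *: v) x; rewrite addrAC subrr add0r enormZ ger0_norm// => h.
rewrite expr2 mulrCA ler_wpM2l ?enorm_ge0//; apply: le_trans h _.
by rewrite ler_wpM2l// ler_piMl ?enorm_ge0.
Qed.

(** First-order optimality without differentiating the norm. With [d] the gradient of the proximal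
    objective at [z], comparing [z] with [z - s d] gives [s |d|^2 <= C s^2 |d|^2] for all [s > 0],
    which forces [d = 0]. *)
Lemma prox_optimality (R : realType) (n : nat) (f : 'rV[R]_n -> R) (L a : R)
    (y z : 'rV[R]_n) :
  0 <= L -> 0 < a -> (forall y, differentiable f y) -> grad_lipschitz L f ->
  argmin (fun z => f z + (2 * a)^-1 * enorm (z - y) ^+ 2) z ->
  z = y - a *: grad f z.
Proof.
move=> L0 a0 df lip zmin.
pose d := grad f z + a^-1 *: (z - y).
suff d0 : d = 0.
  have : a *: d = 0 by rewrite d0 scaler0.
  rewrite scalerDr scalerA divff ?gt_eqF// scale1r => /eqP.
  by rewrite addrA subr_eq0 => /eqP <-; rewrite addrAC subrr add0r.
pose C := L + (2 * a)^-1.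
have C0 : 0 < C by rewrite ltr_wpDl// invr_gt0 mulr_gt0.
have key (s : R) : 0 < s -> enorm d ^+ 2 <= s * (C * enorm d ^+ 2).
  move=> s0; have := zmin (z + - s *: d); have := descent_lemma z (- s *: d) L0 df lip.
  have -> : z + - s *: d - y = (z - y) + - s *: d by rewrite addrAC.
  rewrite (enormD_sqr (z - y)) enormZ normrN gtr0_norm// !dotZr => h1 h2.
  have h3 : dot (grad f z) d + a^-1 * dot (z - y) d = enorm d ^+ 2.
    by rewrite enorm_sqr (_ : dot d d = dot d (grad f z + a^-1 *: (z - y)))// dotDr
      dotZr !(dotC d).
  have : s * enorm d ^+ 2 <= s * (s * (C * enorm d ^+ 2)).
    have h4 := congr1 (fun u => s * u) h3.
    move: h1 h2 h4; rewrite /C /= !exprMn.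
    have -> : (2 * a)^-1 = 2^-1 * a^-1 by rewrite invfM.
    by lra.
  by rewrite ler_pM2l.
apply: enorm_eq0; apply/eqP; rewrite -sqrf_eq0; apply: contraT => dn0.
have dp : 0 < enorm d ^+ 2 by rewrite lt_def dn0 sqr_ge0.
have := key (2 * C)^-1; rewrite invr_gt0 mulr_gt0// => /(_ isT).
have -> : (2 * C)^-1 * (C * enorm d ^+ 2) = enorm d ^+ 2 / 2.
  by field; rewrite gt_eqF.
by lra.
Qed.

(** * The averaged objective and one epoch as a perturbed gradient step *)

Lemma grad_average (R : realType) (n N : nat) (f : 'I_N -> 'rV[R]_n -> R)
    (x : 'rV[R]_n) :
  (forall i, differentiable (f i) x) ->
  grad (average f) x = N%:R^-1 *: \sum_(i < N) grad (f i) x.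
Proof.
move=> df; apply/rowP => j; rewrite !mxE summxE.
have -> : average f = N%:R^-1 \*: (\sum_(i < N) f i).
  by apply/funext => y; rewrite /average fct_sumE.
have dv i : derivable (f i) x (delta_mx ord0 j) by exact: diff_derivable.
rewrite deriveZ; last exact: derivable_sum.
rewrite derive_sum//; congr (_ * _); apply: eq_bigr => i _; by rewrite mxE.
Qed.

Lemma differentiable_average (R : realType) (n N : nat)
    (f : 'I_N -> 'rV[R]_n -> R) (x : 'rV[R]_n) :
  (forall i, differentiable (f i) x) -> differentiable (average f) x.
Proof.
move=> df.
have -> : average f = N%:R^-1 \*: (\sum_(i < N) f i).
  by apply/funext => y; rewrite /average fct_sumE.
by apply: differentiableZ; exact: differentiable_sum.
Qed.

Lemma grad_lipschitz_average (R : realType) (n N : nat) (L : R)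
    (f : 'I_N -> 'rV[R]_n -> R) : (0 < N)%N ->
  (forall i x, differentiable (f i) x) -> (forall i, grad_lipschitz L (f i)) ->
  grad_lipschitz L (average f).
Proof.
move=> N0 df lip x y; rewrite !grad_average// -scalerBr -sumrB enormZ.
rewrite ger0_norm ?invr_ge0// ler_pdivrMl ?ltr0n//.
apply: le_trans (ler_enorm_sum _ _) _.
rewrite -[N in N%:R]card_ord mulr_natl -sumr_const.
by apply: ler_sum => i _; exact: lip.
Qed.

(** A discrete Gronwall argument for the implicit steps. Since [a * L <= 1/2], the new distance can
    be moved to the left-hand side, so [d_(i+1) <= 2 d_i + 2 a G]; the factor [2^(i+1) - 2] solves
    this recursion from [d_0 = 0]. *)
Lemma epoch_drift (R : realType) (n N : nat) (f : 'I_N -> 'rV[R]_n -> R)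
    (L G a : R) (x : 'rV[R]_n) (y : nat -> 'rV[R]_n) :
  0 <= a -> a * L <= 2^-1 -> (forall i, grad_lipschitz L (f i)) ->
  (forall i, enorm (grad (f i) x) <= G) -> y 0%N = x ->
  (forall i : 'I_N, y i.+1 = y i - a *: grad (f i) (y i.+1)) ->
  forall i, (i <= N)%N -> enorm (y i - x) <= (2 ^+ i.+1 - 2) * (a * G).
Proof.
move=> a0 aL lip xG y0 yS; elim=> [_|i IH iN].
  by rewrite y0 subrr enorm0 expr1 subrr mul0r.
have {}IH := IH (ltnW iN); pose k := Ordinal iN.
have yk : y i.+1 = y i - a *: grad (f k) (y i.+1) := yS k.
have h1 : enorm (y i.+1 - x) <=
    enorm (y i - x) + a * enorm (grad (f k) (y i.+1)).
  have -> : y i.+1 - x = (y i - x) + - a *: grad (f k) (y i.+1).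
    by rewrite {1}yk addrAC scaleNr.
  by apply: le_trans (ler_enormD _ _) _; rewrite enormZ normrN ger0_norm.
have h2 : enorm (grad (f k) (y i.+1)) <= L * enorm (y i.+1 - x) + G.
  rewrite -(subrK (grad (f k) x) (grad (f k) (y i.+1))).
  by apply: le_trans (ler_enormD _ _) _; apply: lerD => //; exact: lip.
have h3 := ler_wpM2l a0 h2.
have h4 := ler_wpM2r (enorm_ge0 (y i.+1 - x)) aL.
rewrite exprS.
by lra.
Qed.

(** An epoch visits every component exactly once, so the gradients taken at [x] add up to [N] times
    that of the average whatever the order. The remainder [e] averages the gradient variations,
    which the drift bound makes [O(a)]. *)
Lemma epoch_step (R : realType) (n N : nat) (f : 'I_N -> 'rV[R]_n -> R)
    (L G a : R) (x : 'rV[R]_n) (y : nat -> 'rV[R]_n) (s : 'S_N) :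
  (0 < N)%N -> 0 < L -> 0 < a -> a * L <= 2^-1 ->
  (forall i z, differentiable (f i) z) -> (forall i, grad_lipschitz L (f i)) ->
  (forall i, enorm (grad (f i) x) <= G) -> y 0%N = x ->
  (forall i : 'I_N, argmin (fun z => f (s i) z +
     (2 * a)^-1 * enorm (z - y i) ^+ 2) (y i.+1)) ->
  exists2 e, y N = x - (N%:R * a) *: (grad (average f) x + e)
    & enorm e <= L * 2 ^+ N.+1 * G * a.
Proof.
move=> N0 L0 a0 aL df lip xG y0 ymin.
have yS (i : 'I_N) : y i.+1 = y i - a *: grad (f (s i)) (y i.+1).
  by apply: (prox_optimality (ltW L0)) => //; exact: ymin.
have G0 : 0 <= G by apply: le_trans (xG (Ordinal N0)); exact: enorm_ge0.
have drift (i : 'I_N) : enorm (y i.+1 - x) <= 2 ^+ N.+1 * (a * G).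
  have /= := epoch_drift (f := f \o s) (ltW a0) aL (fun=> lip _) (fun=> xG _)
    y0 yS (ltn_ord i).
  move=> /le_trans; apply; rewrite ler_wpM2r ?mulr_ge0 ?(ltW a0)//.
  have : (2 : R) ^+ i.+2 <= 2 ^+ N.+1 by rewrite ler_weXn2l ?ler1n// ltnS ltn_ord.
  by lra.
have NR : N%:R != 0 :> R by rewrite pnatr_eq0 -lt0n.
pose d (i : 'I_N) := grad (f (s i)) (y i.+1) - grad (f (s i)) x.
exists (N%:R^-1 *: \sum_(i < N) d i); last first.
  rewrite enormZ ger0_norm ?invr_ge0// ler_pdivrMl ?ltr0n//.
  apply: le_trans (ler_enorm_sum _ _) _.
  rewrite -[N in N%:R]card_ord mulr_natl -sumr_const; apply: ler_sum => i _.
  apply: le_trans (lip _ _ _) _.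
  by have := ler_wpM2l (ltW L0) (drift i); lra.
have yE k : (k <= N)%N ->
    y k = x - a *: \sum_(i < N | (i < k)%N) grad (f (s i)) (y i.+1).
  elim: k => [_|k IH kN]; first by rewrite big_pred0// scaler0 subr0.
  rewrite (yS (Ordinal kN)) /= IH 1?ltnW//.
  rewrite [in RHS](bigD1 (Ordinal kN))//= scalerDr opprD addrA addrAC.
  congr (_ - _ - _).
  congr (_ *: _); apply: eq_bigl => i.
  by rewrite ltnS -val_eqE /= ltn_neqAle andbC.
rewrite yE// grad_average// scalerDr !scalerA mulrAC divff// mul1r.
(* Reindexing by the permutation is where the order of the components disappears. *)
rewrite -scalerDr [X in _ *: (X + _)](reindex_inj (@perm_inj _ s)) -big_split/=.
congr (_ - _ *: _); apply: eq_big => i; first by rewrite ltn_ord.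
by move=> _; rewrite /d subrKC.
Qed.

(** Under [h * L <= 1/2] the quadratic term is at most [(h / 2) |g + e|^2]; expanding it cancels the
    cross term exactly, so [e] enters only through its square. *)
Lemma epoch_decrease (R : realType) (n : nat) (F : 'rV[R]_n -> R)
    (L h : R) (x e : 'rV[R]_n) :
  0 <= L -> 0 <= h -> h * L <= 2^-1 ->
  (forall z, differentiable F z) -> grad_lipschitz L F ->
  F (x - h *: (grad F x + e)) <=
    F x - h / 2 * enorm (grad F x) ^+ 2 + h / 2 * enorm e ^+ 2.
Proof.
move=> L0 h0 hL dF lip; rewrite -scaleNr.
apply: le_trans (descent_lemma _ _ L0 dF lip) _.
rewrite dotZr enormZ exprMn normrN (ger0_norm h0) dotDr -enorm_sqr.
rewrite enormD_sqr; set g := enorm _; set d := dot _ _.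
have : h * (h * L) * (g ^+ 2 + 2 * d + enorm e ^+ 2)
    <= h * 2^-1 * (g ^+ 2 + 2 * d + enorm e ^+ 2).
  by rewrite ler_wpM2r -?enormD_sqr ?sqr_ge0// ler_wpM2l.
by lra.
Qed.

(** * The KL inequality along a bounded path *)

(** For gaps below [1] a larger exponent gives a weaker inequality, which is why the radius is
    capped at [1]. A zero gap is covered as well, because [nu > 0]. *)
Lemma KL_exponent_le (R : realType) (n : nat) (F : 'rV[R]_n -> R)
    (z : 'rV[R]_n) (c theta : R) :
  KL_exponent F z c theta ->
  exists2 e, 0 < e & forall x, enorm (x - z) < e -> `|F x - F z| < e ->
    forall nu, theta <= nu -> 0 < nu ->
      `|F x - F z| `^ nu <= c * enorm (grad F x).
Proof.
move=> [c0 /andP[theta0 theta1] [eta [U [eta0 zU KL]]]].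
have [e1 e10 he1] := nbhs_enorm zU.
have [e2 e20 he2] : exists2 e2 : R, 0 < e2 & (e2%:E <= eta)%E.
  case: eta eta0 {KL} => [r r0|_|]//; last by exists 1; rewrite ?leey.
  by exists r => //; rewrite -lte_fin.
pose e := Num.min (Num.min e1 e2) 1.
have e_gt0 : 0 < e by rewrite !lt_min e10 e20 ltr01.
have [ee1 ee2 ee3] : [/\ e <= e1, e <= e2 & e <= 1].
  by rewrite /e !ge_min !lexx !orbT.
exists e => // x xz Fx nu thnu nu0.
have [F0|Fn0] := eqVneq `|F x - F z| 0.
  by rewrite F0 powR0 ?gt_eqF// mulr_ge0 ?enorm_ge0// ltW.
have {Fn0}F0 : 0 < `|F x - F z| by rewrite lt_def Fn0 normr_ge0.
have := KL x (he1 _ (lt_le_trans xz ee1)) F0.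
move=> /(_ (lt_le_trans _ he2)); rewrite lte_fin => /(_ (lt_le_trans Fx ee2)).
move: F0 Fx; set d := `|_| => d0 de.
have dd : is_derive d 1 (lojasiewicz c theta) (c * ((1 - theta) * d `^ (- theta))).
  have -> : lojasiewicz c theta = c \*: (fun s : R => s `^ (1 - theta)) by [].
  apply: is_deriveZ; have := is_derive1_powR (1 - theta) d0.
  by rewrite addrAC subrr add0r.
rewrite derive1E derive_val => h.
have h1 : d `^ theta <= c * (1 - theta) * enorm (grad F x).
  have := ler_wpM2l (powR_ge0 d theta) h; rewrite mulr1; congr (_ <= _).
  by rewrite powRN; field; rewrite gt_eqF// powR_gt0.
have h2 : d `^ nu <= d `^ theta by apply: ger_powR => //; rewrite d0/=; lra.
have h3 : 0 <= c * theta * enorm (grad F x).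
  by rewrite !mulr_ge0 ?enorm_ge0// ltW.
by lra.
Qed.

Lemma bounded_accumulation_point (R : realType) (n : nat)
    (x : nat -> 'rV[R]_n) (B : R) :
  (forall t, enorm (x t) <= B) -> exists z, accumulation_points x z.
Proof.
move=> xB.
have /(_ (x @ \oo)) : compact [set v : 'rV[R]_n | `|v| <= B].
  apply: bounded_closed_compact.
    by exists B; split; [exact: num_real|move=> b /ltW Bb v /= /le_trans; apply].
  rewrite -[X in closed X]/((fun v : 'rV[R]_n => `|v|) @^-1` [set r | r <= B]).
  by apply: closed_comp => [v _|]; [exact: norm_continuous|exact: closed_le].
case=> [|z [_ zcl]].
  by exists 0%N => // t _ /=; apply: le_trans (ler_norm_enorm _) _.
have near_z (e : R) (T : nat) : 0 < e -> exists t, (T <= t)%N /\ enorm (x t - z) < e.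
  move=> e0; have n0 : 0 < n%:R + 1 :> R by rewrite ltr_wpDl.
  have [] := zcl [set x t | t in [set t | (T <= t)%N]] (ball z (e / (n%:R + 1))).
  - by exists T => // t Tt; exists t.
  - by apply: nbhsx_ballx; rewrite divr_gt0.
  move=> _ [[t Tt <-]]; rewrite -ball_normE /= => xt; exists t; split=> //.
  apply: le_lt_trans (enorm_le_norm _) _; rewrite distrC.
  move: xt; rewrite ltr_pdivlMr// => xt; apply: le_lt_trans xt.
  by rewrite mulrC ler_wpM2l// lerDl.
(* Dependent choice runs on pairs of a stage and an index, since the required accuracy depends on
   the stage. *)
have [k kP] : {k : nat -> nat | k 0%N = 0%N /\ forall l,
    (k l < k l.+1)%N /\ enorm (x (k l.+1) - z) < l.+1%:R^-1}.
  have ch (p : nat * nat) : {q : nat * nat | q.1 = p.1.+1 /\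
      (p.2 < q.2)%N /\ enorm (x q.2 - z) < q.1%:R^-1}.
    apply: cid; have [|t [pt xt]] := near_z p.1.+1%:R^-1 p.2.+1.
      by rewrite invr_gt0 ltr0n.
    by exists (p.1.+1, t).
  have [g [g0 gS]] := dependent_choice ch (0, 0)%N.
  have g1 l : (g l).1 = l by elim: l => [|l IH]; [rewrite g0|rewrite (gS l).1 IH].
  exists (fun l => (g l).2); rewrite g0; split=> // l.
  by have [_ []] := gS l; rewrite (g1 l.+1).
exists z, k; split.
  by apply: homo_ltn => [? ? ?|l]; [exact: ltn_trans|exact: (kP.2 l).1].
apply/cvg_enormP => e e0.
have [l le] : exists l : nat, e^-1 < l%:R.
  by exists (Num.truncn e^-1).+1; rewrite truncnS_gt.
exists l.+1 => -[//|m] lm; apply: lt_trans (kP.2 m).2 _.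
rewrite invf_plt ?posrE ?ltr0n//; apply: lt_le_trans le _.
by rewrite ler_nat (leq_trans _ lm)// ltnW.
Qed.

(** While the path stays in the ball, [enorm (x t - z) + w t] cannot increase; starting it small
    near [z] keeps the path inside for ever. Since the start may be arbitrarily late and close, the
    path converges. *)
Lemma trapped_cvg (R : realType) (n : nat) (x : nat -> 'rV[R]_n)
    (z : 'rV[R]_n) (w : nat -> R) (e0 : R) (T0 : nat) :
  (forall t, (T0 <= t)%N -> 0 <= w t) ->
  (forall e, 0 < e -> exists T, forall t, (T <= t)%N -> w t < e) ->
  (forall e T, 0 < e -> exists t, (T <= t)%N /\ enorm (x t - z) < e) ->
  0 < e0 ->
  (forall t, (T0 <= t)%N -> enorm (x t - z) < e0 ->
     enorm (x t.+1 - x t) <= w t - w t.+1) ->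
  x t @[t --> \oo] --> z /\
  exists T, forall t, (T <= t)%N -> enorm (x t - z) <= w t.
Proof.
move=> w0 wcvg near_z e00 step.
have xz : x t @[t --> \oo] --> z.
  apply/cvg_enormP => e1 e10; pose e := Num.min e0 e1.
  have e_gt0 : 0 < e by rewrite lt_min e00.
  have e2 : 0 < e / 2 by rewrite divr_gt0.
  have [T wT] := wcvg _ e2.
  have [t0 [Tt0 xt0]] := near_z _ (maxn T0 T) e2.
  have [T0t0 Tt0'] : (T0 <= t0)%N /\ (T <= t0)%N by move: Tt0; rewrite geq_max => /andP.
  have {wT}wt0 := wT _ Tt0'.
  exists t0 => t tt0.
  suff h : enorm (x t - z) + w t < e.
    have : e <= e1 by rewrite ge_min lexx orbT.
    by have := w0 t (leq_trans T0t0 tt0); lra.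
  rewrite -(subnKC tt0); elim: (t - t0)%N => [|k IH]; first by rewrite addn0; lra.
  have T0k : (T0 <= t0 + k)%N by rewrite (leq_trans T0t0) ?leq_addr.
  have xe : enorm (x (t0 + k)%N - z) < e0.
    have : e <= e0 by rewrite ge_min lexx.
    by have := w0 _ T0k; lra.
  rewrite addnS; have := step _ T0k xe.
  by have := ler_enormB (x (t0 + k).+1) (x (t0 + k)%N) z; lra.
split=> //; move/cvg_enormP : xz => xz.
have [T1 xT1] := xz _ e00; exists (maxn T0 T1) => t; rewrite geq_max => /andP[Tt T1t].
(* The difference [enorm (x t - z) - w t] is nondecreasing and its upper limit is nonpositive, so it
   is never positive. *)
have ind k : enorm (x t - z) - w t <= enorm (x (t + k)%N - z) - w (t + k)%N.
  elim: k => [|k IH]; first by rewrite addn0.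
  have Tk : (T0 <= t + k)%N by rewrite (leq_trans Tt) ?leq_addr.
  have T1k : (T1 <= t + k)%N by rewrite (leq_trans T1t) ?leq_addr.
  rewrite addnS; have := step _ Tk (xT1 _ T1k).
  have := ler_enormB (x (t + k)%N) (x (t + k).+1) z.
  by rewrite (enorm_distC (x (t + k)%N) (x _.+1)); lra.
rewrite leNgt; apply/negP; rewrite -subr_gt0 => d0.
have [T2 xT2] := xz _ d0.
have := ind T2; have := xT2 (t + T2)%N (leq_addl _ _).
by have := w0 (t + T2)%N (leq_trans Tt (leq_addr _ _)); lra.
Qed.

(** * Step sizes, the decreasing energy and the length of the path *)

Lemma shift_ge1 (R : realType) (beta : R) (t : nat) :
  (0 < t)%N -> 0 <= beta -> 1 <= t%:R + beta.
Proof. by move=> t0 b0; rewrite ler_wpDr// ler1n. Qed.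

Lemma step_size_gt0 (R : realType) (alpha beta gamma : R) (t : nat) :
  0 < alpha -> 0 <= beta -> 0 < step_size alpha beta gamma t.+1.
Proof.
by move=> a0 b0; rewrite divr_gt0// powR_gt0// ltr_wpDr// ltr0n.
Qed.

Lemma step_sizeE (R : realType) (alpha beta gamma : R) (t : nat) :
  step_size alpha beta gamma t = alpha * (t%:R + beta) `^ (- gamma).
Proof. by rewrite powRN. Qed.

(** Used with [k = 3] for the error in the function values and with [k = 2] for the error in the
    path length. *)
Lemma step_size_tail (R : realType) (alpha beta gamma : R) (k t : nat) :
  0 < alpha -> 0 <= beta -> 1 < k%:R * gamma -> (0 < t)%N ->
  step_size alpha beta gamma t.+1 ^+ k <= alpha ^+ k / (k%:R * gamma - 1) *
    ((t%:R + beta) `^ (- (k%:R * gamma - 1)) -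
     (t.+1%:R + beta) `^ (- (k%:R * gamma - 1))).
Proof.
move=> a0 b0 kg t0; have s1 := shift_ge1 t0 b0.
rewrite step_sizeE exprMn -(powR_mulrn k (powR_ge0 _ _)) -powRrM -mulrA.
rewrite ler_wpM2l ?exprn_ge0 ?(ltW a0)// ler_pdivlMl ?subr_gt0//.
have -> : t.+1%:R + beta = (t%:R + beta) + 1 by rewrite -natr1; lra.
apply: le_trans (powR_diff_ge _ _); [|lra|lra].
by rewrite subrK mulNr (mulrC gamma).
Qed.

Lemma powR_tail_lt (R : realType) (beta p e : R) :
  0 <= beta -> 0 < p -> 0 < e ->
  exists T, forall t, (T <= t)%N -> (t%:R + beta) `^ (- p) < e.
Proof.
move=> b0 p0 e0; exists (Num.truncn (e^-1 `^ p^-1)).+1 => t Tt.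
have h : e^-1 `^ p^-1 < t%:R + beta.
  apply: (@lt_le_trans _ _ t%:R); last by rewrite lerDl.
  by apply: lt_le_trans (truncnS_gt _) _; rewrite ler_nat.
have ip : 0 < e^-1 `^ p^-1 by rewrite powR_gt0// invr_gt0.
rewrite powRN invf_plt ?posrE ?powR_gt0//; last exact: lt_trans h.
have -> : e^-1 = (e^-1 `^ p^-1) `^ p.
  by rewrite -powRrM mulVf ?gt_eqF// powRr1// invr_ge0 ltW.
by apply: gt0_ltr_powR => //; rewrite nnegrE ltW// (lt_trans ip).
Qed.

Lemma powR_lt_small (R : realType) (r p e : R) :
  0 <= r -> 0 < p -> 0 < e -> r < e `^ p^-1 -> r `^ p < e.
Proof.
move=> r0 p0 e0 re; rewrite -[ltRHS](powRr1 (ltW e0)).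
rewrite -(@mulVf _ p) ?gt_eqF// powRrM.
by apply: gt0_ltr_powR => //; rewrite nnegrE// powR_ge0.
Qed.

Lemma energy_cvg (R : realType) (E : nat -> R) (m : R) (T : nat) :
  (forall t, (T <= t)%N -> E t.+1 <= E t) -> (forall t, (T <= t)%N -> m <= E t) ->
  exists2 l, forall t, (T <= t)%N -> l <= E t &
    forall e, 0 < e -> exists T', forall t, (T' <= t)%N -> `|E t - l| < e.
Proof.
move=> dec Em; pose y k := E (T + k)%N.
have ydec : nonincreasing_seq y.
  by apply/nonincreasing_seqP => k; rewrite /y addnS dec// leq_addr.
have ycvg : cvgn y.
  apply: nonincreasing_is_cvgn => //.
  by exists m => _ [k _ <-]; rewrite /y Em// leq_addr.
exists (limn y).
  move=> t Tt; have := nonincreasing_cvgn_ge ydec ycvg (t - T)%N.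
  by rewrite /y subnKC.
move=> e e0; have /cvgrPdist_lt/(_ _ e0)[T' _ hT'] := ycvg.
exists (T + T')%N => t Tt.
have := hT' (t - T)%N; rewrite /= /y subnKC ?(leq_trans (leq_addr _ _) Tt)//.
by rewrite distrC; apply; rewrite leq_subRL// (leq_trans (leq_addr _ _) Tt).
Qed.

(** The interface between the method and its analysis: the permutations and inner iterates no longer
    appear. *)
Record perturbed_descent (R : realType) (n : nat) (F : 'rV[R]_n -> R)
    (x : nat -> 'rV[R]_n) (a : nat -> R) (c0 M A1 A2 : R) (T : nat) : Prop := {
  descent_value : forall t, (T <= t)%N ->
    F (x t.+1) <= F (x t) - c0 * a t.+1 * enorm (grad F (x t)) ^+ 2
                  + M * a t.+1 ^+ 3;
  descent_length : forall t, (T <= t)%N ->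
    enorm (x t.+1 - x t) <= A1 * (a t.+1 * enorm (grad F (x t)))
                            + A2 * a t.+1 ^+ 2 }.

(* [M * a_t ^ 3] is dominated by the decrements of [error_tail]. *)
Definition error_tail (R : realType) (M alpha beta gamma : R) (t : nat) : R :=
  M * alpha ^+ 3 / (3 * gamma - 1) * (t%:R + beta) `^ (- (3 * gamma - 1)).

Lemma error_tail_ge0 (R : realType) (M alpha beta gamma : R) (t : nat) :
  0 <= M -> 0 <= alpha -> 2^-1 < gamma -> 0 <= error_tail M alpha beta gamma t.
Proof.
by move=> M0 a0 g0; rewrite mulr_ge0 ?powR_ge0// divr_ge0 ?mulr_ge0 ?exprn_ge0//; lra.
Qed.

Lemma error_tail_lt (R : realType) (M alpha beta gamma e : R) :
  0 <= M -> 0 <= alpha -> 0 <= beta -> 2^-1 < gamma -> 0 < e ->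
  exists T, forall t, (T <= t)%N -> error_tail M alpha beta gamma t < e.
Proof.
move=> M0 a0 b0 g0 e0; pose U := M * alpha ^+ 3 / (3 * gamma - 1).
have U0 : 0 <= U by rewrite divr_ge0 ?mulr_ge0 ?exprn_ge0//; lra.
have U1 : 0 < U + 1 by lra.
have [||T hT] := @powR_tail_lt _ beta (3 * gamma - 1) (e / (U + 1)) b0.
- by lra.
- by rewrite divr_gt0.
exists T => t /hT; rewrite ltr_pdivlMr//; rewrite /error_tail -/U.
by have := powR_ge0 (t%:R + beta) (- (3 * gamma - 1)); lra.
Qed.

Lemma perturbed_descent_energy (R : realType) (n : nat) (F : 'rV[R]_n -> R)
    (x : nat -> 'rV[R]_n) (alpha beta gamma c0 M A1 A2 : R) (T : nat) :
  0 < alpha -> 0 <= beta -> 2^-1 < gamma -> 0 <= c0 -> 0 <= M -> (0 < T)%N ->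
  has_lbound (range F) ->
  perturbed_descent F x (step_size alpha beta gamma) c0 M A1 A2 T ->
  let u := error_tail M alpha beta gamma in
  exists l : R, [/\
    forall t, (T <= t)%N -> 0 <= F (x t) + u t - l,
    forall t, (T <= t)%N ->
      c0 * step_size alpha beta gamma t.+1 * enorm (grad F (x t)) ^+ 2 <=
      (F (x t) + u t - l) - (F (x t.+1) + u t.+1 - l),
    forall e, 0 < e -> exists T', forall t, (T' <= t)%N ->
      F (x t) + u t - l < e &
    forall e, 0 < e -> exists T', forall t, (T' <= t)%N -> `|F (x t) - l| < e].
Proof.
move=> a0 b0 g0 c00 M0 T0 [m Fm] [pd _] u.
have dec t : (T <= t)%N -> c0 * step_size alpha beta gamma t.+1 *
    enorm (grad F (x t)) ^+ 2 <= (F (x t) + u t) - (F (x t.+1) + u t.+1).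
  move=> Tt; have h := pd _ Tt.
  have := @step_size_tail _ alpha beta gamma 3 t a0 b0.
  have -> : 1 < 3%:R * gamma by lra.
  move=> /(_ isT (leq_trans T0 Tt))/(ler_wpM2l M0).
  by rewrite /u /error_tail; lra.
have [||l lE Ecvg] := @energy_cvg _ (fun t => F (x t) + u t) m T.
- move=> t Tt; have := dec t Tt.
  have : 0 <= c0 * step_size alpha beta gamma t.+1 * enorm (grad F (x t)) ^+ 2.
    by rewrite mulr_ge0 ?sqr_ge0// mulr_ge0// ltW// step_size_gt0.
  by lra.
- move=> t Tt; rewrite ler_wpDr//; last by apply: Fm; exists (x t).
  by apply: error_tail_ge0 => //; exact: ltW.
exists l; split.
- by move=> t /lE; lra.
- by move=> t /dec; lra.
- move=> e /Ecvg[T' hT']; exists T' => t /hT'; exact: le_lt_trans (ler_norm _).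
- move=> e e0; have e2 : 0 < e / 2 by lra.
  have [T1 hT1] := Ecvg _ e2.
  have [T2 hT2] := error_tail_lt M0 (ltW a0) b0 g0 e2.
  exists (maxn T1 T2) => t; rewrite geq_max => /andP[/hT1 h1 /hT2 h2].
  have h3 : 0 <= u t by apply: error_tail_ge0 => //; exact: ltW.
  have -> : F (x t) - l = (F (x t) + u t - l) - u t by ring.
  by apply: le_lt_trans (ler_normB _ _) _; rewrite (ger0_norm h3) /u; lra.
Qed.

(* Raising the exponent [theta] to [gamma / (3 gamma - 1)] makes the power
   [u_t ^ nu] of the error tail at most of the order of the step size. *)
Lemma local_KL_bound (R : realType) (n : nat) (F : 'rV[R]_n -> R)
    (x : nat -> 'rV[R]_n) (alpha beta gamma M l c theta : R) (z : 'rV[R]_n) :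
  0 < alpha -> 0 <= beta -> 2^-1 < gamma -> 0 <= M ->
  KL_exponent F z c theta -> F z = l ->
  (forall e, 0 < e -> exists T', forall t, (T' <= t)%N -> `|F (x t) - l| < e) ->
  let nu := Num.max theta (gamma / (3 * gamma - 1)) in
  exists T q e, [/\ 0 <= q, 0 < e & forall t, (T <= t)%N -> enorm (x t - z) < e ->
    `|F (x t) - l| `^ nu <= c * enorm (grad F (x t)) /\
    (0 <= F (x t) + error_tail M alpha beta gamma t - l ->
      (F (x t) + error_tail M alpha beta gamma t - l) `^ nu <=
      2 * c * enorm (grad F (x t)) + q * step_size alpha beta gamma t.+1)].
Proof.
move=> a0 b0 g0 M0 KL Fz Fcvg nu.
have g31 : 0 < 3 * gamma - 1 by lra.
have nu0 : 0 < nu by rewrite lt_max divr_gt0 ?orbT//; lra.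
have nu1 : nu <= 1.
  case: KL => [_ /andP[_ th1] _]; rewrite ge_max (ltW th1)/=.
  by rewrite ler_pdivrMr//; lra.
have thnu : theta <= nu by rewrite le_max lexx.
have gnu : gamma <= (3 * gamma - 1) * nu.
  by rewrite mulrC -ler_pdivrMr// le_max lexx orbT.
have [e e0 he] := KL_exponent_le KL; have [T hT] := Fcvg _ e0.
pose U := M * alpha ^+ 3 / (3 * gamma - 1).
have U0 : 0 <= U by rewrite divr_ge0 ?mulr_ge0 ?exprn_ge0// ltW.
(* In [q], the [2] comes from [ler_powRDD], [U^nu] from the coefficient of the tail, [2^gamma] from
   passing from [t] to [t.+1], and [alpha] from the normalization of the step size. *)
exists T.+1, (2 * U `^ nu * 2 `^ gamma / alpha), e; split=> //.
  by rewrite divr_ge0 ?mulr_ge0 ?powR_ge0// ltW.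
move=> t Tt xz.
have s1 := shift_ge1 (leq_ltn_trans (leq0n _) Tt) b0.
have h1 : `|F (x t) - l| `^ nu <= c * enorm (grad F (x t)).
  by rewrite -Fz; apply: he => //; rewrite Fz; exact: hT (ltnW Tt).
split=> // r0; set u := error_tail _ _ _ _ _ in r0 *.
have u0 : 0 <= u by apply: error_tail_ge0 => //; exact: ltW.
have h2 : (F (x t) + u - l) `^ nu <= (`|F (x t) - l| + u) `^ nu.
  apply: ge0_ler_powR; rewrite ?nnegrE ?(ltW nu0)//; first exact: addr_ge0.
  by have := ler_norm (F (x t) - l); lra.
have h3 := @ler_powRDD _ `|F (x t) - l| u nu (normr_ge0 _) u0.
have := h3; rewrite (ltW nu0) nu1 => /(_ isT) {}h3.
suff h4 : u `^ nu <= U `^ nu * 2 `^ gamma / alpha * step_size alpha beta gamma t.+1.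
  by lra.
rewrite step_sizeE [leRHS](_ : _ = U `^ nu * (2 `^ gamma *
  (t.+1%:R + beta) `^ (- gamma))); last by field; rewrite gt_eqF.
rewrite /u /error_tail -/U powRM ?powR_ge0// ler_wpM2l ?powR_ge0//.
set s := t%:R + beta in s1 *.
rewrite -powRrM; apply: (@le_trans _ _ (s `^ (- gamma))).
  by apply: ler_powR => //; rewrite mulNr lerN2.
have -> : t.+1%:R + beta = s + 1 by rewrite -natr1 /s; lra.
rewrite !powRN ler_pdivlMr ?powR_gt0//; last lra.
rewrite ler_pdivrMl ?powR_gt0//; last lra.
rewrite -powRM; [|lra|lra].
by apply: ge0_ler_powR; rewrite ?nnegrE; lra.
Qed.

(** [desingularized_decrease] with [kappa = 2 * c] bounds [a * D] by a difference of powers of [r]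
    plus a multiple of [a^2], and [step_size_tail] makes [a^2] telescope too. Here [p] stands for
    [1 - nu]. *)
Lemma local_length (R : realType) (n : nat) (F : 'rV[R]_n -> R)
    (x : nat -> 'rV[R]_n) (alpha beta gamma c0 M A1 A2 l c q p e : R) (T : nat)
    (z : 'rV[R]_n) :
  0 < alpha -> 0 <= beta -> 2^-1 < gamma -> 0 < c0 -> 0 <= A1 -> 0 <= A2 ->
  0 < c -> 0 <= q -> 0 < p < 1 -> (0 < T)%N ->
  let a := step_size alpha beta gamma in
  let r := fun t => F (x t) + error_tail M alpha beta gamma t - l in
  (forall t, (T <= t)%N -> enorm (x t.+1 - x t) <=
     A1 * (a t.+1 * enorm (grad F (x t))) + A2 * a t.+1 ^+ 2) ->
  (forall t, (T <= t)%N -> 0 <= r t) ->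
  (forall t, (T <= t)%N ->
     c0 * a t.+1 * enorm (grad F (x t)) ^+ 2 <= r t - r t.+1) ->
  (forall t, (T <= t)%N -> enorm (x t - z) < e ->
     r t `^ (1 - p) <= 2 * c * enorm (grad F (x t)) + q * a t.+1) ->
  exists A B, [/\ 0 <= A, 0 <= B & let w := fun t =>
      A * r t `^ p + B * (t%:R + beta) `^ (- (2 * gamma - 1)) in
    forall t, (T <= t)%N -> enorm (x t - z) < e ->
      enorm (x t.+1 - x t) <= w t - w t.+1].
Proof.
move=> a0 b0 g0 c00 A10 A20 c_gt0 q0 p01 T0 a r len r0 dec kl.
have p0 : 0 < p by case/andP: p01.
exists (A1 * (2 * c / (c0 * p))),
  ((A1 * (q / (2 * c)) + A2) * (alpha ^+ 2 / (2 * gamma - 1))).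
have c2 : 0 < 2 * c by lra.
have A1' : 0 <= A1 * (q / (2 * c)) by rewrite mulr_ge0// divr_ge0// ltW.
split.
- by rewrite mulr_ge0// divr_ge0 ?(ltW c2)// mulr_ge0// ltW.
- by rewrite mulr_ge0 ?addr_ge0// divr_ge0 ?sqr_ge0//; lra.
move=> /= t Tt xz; apply: le_trans (len _ Tt) _.
have at0 : 0 < a t.+1 by exact: step_size_gt0.
have h0 : 0 <= c0 * a t.+1 by rewrite mulr_ge0// ltW.
have := @desingularized_decrease _ (r t) (r t.+1) (enorm (grad F (x t)))
  (c0 * a t.+1) (2 * c) (q * a t.+1) p (r0 _ (leqW Tt)) (enorm_ge0 _) h0 c2.
move=> /(_ (mulr_ge0 q0 (ltW at0)) p01 (dec _ Tt) (kl _ Tt xz)).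
move: (r t `^ p) (r t.+1 `^ p) (enorm _) => y y' D des.
have h1 : a t.+1 * D <= 2 * c / (c0 * p) * (y - y') + q / (2 * c) * a t.+1 ^+ 2.
  rewrite -(ler_pM2l c00); move: des; congr (_ <= _); first by ring.
  by field; rewrite !gt_eqF.
have h2 : a t.+1 ^+ 2 <= alpha ^+ 2 / (2 * gamma - 1) *
    ((t%:R + beta) `^ (- (2 * gamma - 1)) -
     (t.+1%:R + beta) `^ (- (2 * gamma - 1))).
  by apply: (@step_size_tail _ _ _ _ 2) => //; [lra|exact: leq_trans Tt].
have h3 := ler_wpM2l A10 h1.
have h4 := ler_wpM2l (addr_ge0 A1' A20) h2.
by move: h3 h4; clear; lra.
Qed.

(** * Convergence rates *)

Lemma sublinear_value_rate (R : realType) (r D : nat -> R)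
    (alpha beta gamma c0 c q nu : R) (T : nat) :
  0 < alpha -> 0 <= beta -> 2^-1 < gamma < 1 -> 0 < c0 -> 0 < c -> 0 <= q ->
  gamma / (3 * gamma - 1) <= nu -> (0 < T)%N ->
  let a := step_size alpha beta gamma in
  (forall t, (T <= t)%N -> 0 <= r t) ->
  (forall t, (T <= t)%N -> c0 * a t.+1 * D t ^+ 2 <= r t - r t.+1) ->
  (forall t, (T <= t)%N -> r t `^ nu <= 2 * c * D t + q * a t.+1) ->
  exists2 Q, 0 <= Q & forall t, (T <= t)%N ->
    r t <= Q * (t%:R + beta) `^ (- ((1 - gamma) / (2 * nu - 1))).
Proof.
move=> a0 b0 /andP[g0 g1] c00 c_gt0 q0 nug T0 a r0 dec kl.
have g31 : 0 < 3 * gamma - 1 by lra.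
have nug' : gamma <= nu * (3 * gamma - 1) by rewrite -ler_pdivrMr.
have nu2 : 0 < 2 * nu - 1.
  rewrite -(pmulr_lgt0 _ g31); lra.
(* This [p] balances the recursion, [gamma + 2 nu p = p + 1]; the lower bound on [nu] is what gives
   [p + 1 <= 3 * gamma], so the cubic error does not dominate. *)
set p := (1 - gamma) / _.
have p0 : 0 <= p by rewrite divr_ge0 ?(ltW nu2)//; lra.
have pE : p * (2 * nu - 1) = 1 - gamma by rewrite /p divfK// gt_eqF.
have p3 : p + 1 <= 3 * gamma.
  rewrite -lerBrDr /p ler_pdivrMr//; lra.
have b1 : 0 < c0 * alpha / (8 * c ^+ 2).
  by rewrite divr_gt0 ?mulr_gt0 ?exprn_gt0.
have M1 : 0 <= c0 * q ^+ 2 / (4 * c ^+ 2) * alpha ^+ 3.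
  rewrite mulr_ge0 ?exprn_ge0 ?(ltW a0)//; apply: divr_ge0.
  - by rewrite mulr_ge0 ?sqr_ge0// ltW.
  - by rewrite mulr_ge0 ?sqr_ge0.
apply: (@power_rate _ r beta gamma (2 * nu) p _ _ T T0 b0 _ _ p0 b1 M1) => //.
- by lra.
- by lra.
- by lra.
move=> t Tt; have at0 : 0 < a t.+1 by exact: step_size_gt0.
(* Squaring the KL bound turns the gradient term of the decrease into a multiple of [r^(2 nu)], the
   form required by [power_rate] with [e = 2 * nu]. *)
have h1 : r t `^ (2 * nu) <= (2 * c * D t + q * a t.+1) ^+ 2.
  rewrite mulrC powRrM (@powR_mulrn _ _ 2) ?powR_ge0//.
  by rewrite ler_pXn2r ?nnegrE ?kl// ?(le_trans _ (kl _ Tt)) ?powR_ge0.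
have h2 : (2 * c * D t + q * a t.+1) ^+ 2 <=
    8 * c ^+ 2 * D t ^+ 2 + 2 * q ^+ 2 * a t.+1 ^+ 2.
  by have := sqr_ge0 (2 * c * D t - q * a t.+1); lra.
have k0 : 0 <= c0 * a t.+1 / (8 * c ^+ 2).
  by apply: divr_ge0; rewrite mulr_ge0 ?sqr_ge0// ltW.
have h3 := ler_wpM2l k0 (le_trans h1 h2).
have h4 : c0 * a t.+1 / (8 * c ^+ 2) *
    (8 * c ^+ 2 * D t ^+ 2 + 2 * q ^+ 2 * a t.+1 ^+ 2) =
    c0 * a t.+1 * D t ^+ 2 + c0 * q ^+ 2 / (4 * c ^+ 2) * a t.+1 ^+ 3.
  by field; rewrite gt_eqF.
have h5 := dec _ Tt.
have a3 : a t.+1 ^+ 3 = alpha ^+ 3 * (t.+1%:R + beta) `^ (- (3 * gamma)).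
  rewrite /a step_sizeE exprMn -(powR_mulrn 3 (powR_ge0 _ _)) -powRrM.
  by rewrite mulNr (mulrC gamma).
move: h3; rewrite h4 a3 {1}/a step_sizeE => h3.
by move: h3 h5; clear; lra.
Qed.

(* For [gamma = 1] the KL bound is applied to the gap [|F x_t - l|] itself:
   splitting off the error tail first would worsen the KL constant. *)
Lemma linear_value_rate (R : realType) (r phi D : nat -> R)
    (alpha beta c0 c U : R) (T : nat) :
  0 < alpha -> 0 <= beta -> 0 < c0 -> 0 < c -> 0 <= U -> 4 * c ^+ 2 < c0 * alpha ->
  (3 <= T)%N ->
  (forall t, (T <= t)%N -> 0 <= r t) ->
  (forall t, r t = phi t + U * (t%:R + beta) `^ (- 2)) ->
  (forall t, (T <= t)%N ->
     c0 * step_size alpha beta 1 t.+1 * D t ^+ 2 <= r t - r t.+1) ->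
  (forall t, (T <= t)%N -> `|phi t| `^ 2^-1 <= c * D t) ->
  exists2 Q, 0 <= Q &
    forall t, (T <= t)%N -> r t <= Q / (t%:R + beta) ^+ 2.
Proof.
move=> a0 b0 c00 c_gt0 U0 hc T3 r0 rE dec kl.
apply: (@inverse_square_rate _ r beta U T T3 b0 U0 r0) => t Tt.
have s1 := shift_ge1 (leq_trans (isT : 0 < 3)%N (leq_trans T3 Tt)) b0.
have s1' := @shift_ge1 R beta t.+1 isT b0.
have -> : r t - U / (t%:R + beta) ^+ 2 = phi t.
  by rewrite rE (powR_invn 2) ?addrK//; lra.
have at0 := step_size_gt0 1 t a0 b0.
have h0 : r t.+1 <= r t.
  have : 0 <= c0 * step_size alpha beta 1 t.+1 * D t ^+ 2.
    by rewrite mulr_ge0 ?sqr_ge0// mulr_ge0// ltW.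
  by have := dec _ Tt; lra.
(* If the gap is nonpositive, the claim is weaker than the monotonicity of [r]. *)
have [ph|ph] := leP (phi t) 0.
  have : 4 / (t.+1%:R + beta) * phi t <= 0.
    by rewrite mulr_ge0_le0// divr_ge0//; lra.
  by lra.
have h1 : phi t <= c ^+ 2 * D t ^+ 2.
  have := kl _ Tt; rewrite (gtr0_norm ph) => h.
  have -> : phi t = (phi t `^ 2^-1) ^+ 2.
    by rewrite -(powR_mulrn 2 (powR_ge0 _ _)) -powRrM mulVf// powRr1 ?ltW.
  by rewrite -exprMn ler_pXn2r ?nnegrE ?powR_ge0// (le_trans _ h) ?powR_ge0.
have h2 := dec _ Tt; move: h2; rewrite /step_size powRr1; last lra.
set s := _ + beta in s1' *; move=> h2.
have h3 : 4 * phi t <= c0 * alpha * D t ^+ 2.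
  have := ler_wpM2r (sqr_ge0 (D t)) (ltW hc); lra.
have h4 : 4 / s * phi t <= c0 * (alpha / s) * D t ^+ 2.
  have -> : 4 / s * phi t = s^-1 * (4 * phi t) by ring.
  have -> : c0 * (alpha / s) * D t ^+ 2 = s^-1 * (c0 * alpha * D t ^+ 2) by ring.
  by rewrite ler_wpM2l// invr_ge0; lra.
by lra.
Qed.

Lemma rescaled_le (R : realType) (d : nat -> R) (beta rho Q : R) (T : nat) :
  0 <= beta -> 0 <= rho -> 0 <= Q -> (0 < T)%N ->
  (forall t, (T <= t)%N -> d t <= Q * (t%:R + beta) `^ (- rho)) ->
  forall t, (T <= t)%N -> t%:R `^ rho * d t <= Q.
Proof.
move=> b0 rho0 Q0 T0 h t Tt; have t0 : 0 < t%:R :> R by rewrite ltr0n (leq_trans T0).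
apply: le_trans (ler_wpM2l (powR_ge0 _ _) (h _ Tt)) _.
rewrite powRN mulrCA -[leRHS]mulr1 ler_wpM2l// ler_pdivrMr.
  by rewrite mul1r; apply: ge0_ler_powR; rewrite ?nnegrE//; lra.
by rewrite powR_gt0//; lra.
Qed.

(** The raised exponent merges the first two branches of [rate]: at the threshold
    [gamma / (3 gamma - 1)] the second formula equals [2 gamma - 1]. *)
Lemma rate_lt1 (R : realType) (N : nat) (alpha gamma theta c : R) :
  2^-1 < gamma < 1 -> 0 <= theta < 1 ->
  let nu := Num.max theta (gamma / (3 * gamma - 1)) in
  rate N alpha gamma theta c = (1 - gamma) / (2 * nu - 1) * (1 - nu).
Proof.
move=> /andP[g0 g1] /andP[th0 th1] nu.
have g31 : 0 < 3 * gamma - 1 by lra.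
rewrite /rate /nu th0 th1 g0 g1 !andbT /=.
case: ltP => thg; last by ring.
by field; apply/andP; split; apply/eqP; lra.
Qed.

(** Of the two terms of the potential, the power of [r] has the slower guaranteed decay, so it alone
    determines the rate. *)
Lemma rate_exponent_le (R : realType) (gamma nu : R) :
  2^-1 < gamma < 1 -> gamma / (3 * gamma - 1) <= nu < 1 ->
  0 <= (1 - gamma) / (2 * nu - 1) * (1 - nu) <= 2 * gamma - 1.
Proof.
move=> /andP[g0 g1] /andP[nug nu1].
have g31 : 0 < 3 * gamma - 1 by lra.
have nug' : gamma <= nu * (3 * gamma - 1) by rewrite -ler_pdivrMr.
have nu2 : 0 < 2 * nu - 1 by rewrite -(pmulr_lgt0 _ g31); lra.
apply/andP; split.
  by rewrite mulr_ge0 ?divr_ge0 ?(ltW nu2)//; lra.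
by rewrite mulrAC ler_pdivrMr//; lra.
Qed.

Lemma rate_eq1 (R : realType) (N : nat) (alpha theta c : R) :
  rate N alpha 1 theta c =
  if [&& 0 <= theta, theta <= 2^-1 & 8 * c ^+ 2 / N%:R < alpha] then 1 else 0.
Proof. by rewrite /rate ltxx !andbF eqxx. Qed.

Lemma KL_convergence (R : realType) (n N : nat) (F : 'rV[R]_n -> R)
    (x : nat -> 'rV[R]_n) (alpha beta gamma M A1 A2 l c theta : R)
    (z : 'rV[R]_n) (T : nat) :
  (0 < N)%N -> 0 < alpha -> 0 <= beta -> 2^-1 < gamma <= 1 ->
  0 <= M -> 0 <= A1 -> 0 <= A2 ->
  let a := step_size alpha beta gamma in
  let r := fun t => F (x t) + error_tail M alpha beta gamma t - l in
  (forall t, (T <= t)%N -> enorm (x t.+1 - x t) <=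
     A1 * (a t.+1 * enorm (grad F (x t))) + A2 * a t.+1 ^+ 2) ->
  (forall t, (T <= t)%N -> 0 <= r t) ->
  (forall t, (T <= t)%N ->
     N%:R / 2 * a t.+1 * enorm (grad F (x t)) ^+ 2 <= r t - r t.+1) ->
  (forall e, 0 < e -> exists T', forall t, (T' <= t)%N -> r t < e) ->
  (forall e, 0 < e -> exists T', forall t, (T' <= t)%N -> `|F (x t) - l| < e) ->
  KL_exponent F z c theta -> F z = l ->
  (forall e T', 0 < e -> exists t, (T' <= t)%N /\ enorm (x t - z) < e) ->
  x t @[t --> \oo] --> z /\
  exists Q T', forall t, (T' <= t)%N ->
    t%:R `^ rate N alpha gamma theta c * enorm (x t - z) <= Q.
Proof.
move=> N0 a0 b0 /andP[g0 g1] M0 A10 A20 a r len r0 dec rcvg Fcvg KL Fz near_z.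
have [c_gt0 th01 _] := KL; have /andP[th0 th1] := th01.
have NR : 0 < N%:R :> R by rewrite ltr0n.
have c00 : 0 < N%:R / 2 :> R by lra.
have g31 : 0 < 3 * gamma - 1 by lra.
pose nu := Num.max theta (gamma / (3 * gamma - 1)).
have nug : gamma / (3 * gamma - 1) <= nu by rewrite le_max lexx orbT.
have gp : 0 < gamma / (3 * gamma - 1) by rewrite divr_gt0//; lra.
have nu01 : 0 < nu < 1.
  rewrite (lt_le_trans gp nug) gt_max th1 /=.
  by rewrite ltr_pdivrMr//; lra.
have /andP[nu0 nu1] := nu01.
have p0 : 0 < 1 - nu by lra.
have [T1 [q [e [q0 e0 kl]]]] := local_KL_bound a0 b0 g0 M0 KL Fz Fcvg.
rewrite -/nu in kl.
pose T2 := maxn (maxn T T1) 3.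
have T2T t : (T2 <= t)%N -> (T <= t)%N.
  by rewrite !geq_max => /andP[/andP[]].
have T2T1 t : (T2 <= t)%N -> (T1 <= t)%N.
  by rewrite !geq_max => /andP[/andP[]].
have T23 t : (T2 <= t)%N -> (3 <= t)%N by rewrite geq_max => /andP[].
have T20 t : (T2 <= t)%N -> (0 < t)%N by move=> /T23; apply: leq_trans.
have r02 t : (T2 <= t)%N -> 0 <= r t by move=> /T2T; exact: r0.
have dec2 t : (T2 <= t)%N ->
    N%:R / 2 * a t.+1 * enorm (grad F (x t)) ^+ 2 <= r t - r t.+1.
  by move=> /T2T; exact: dec.
have kl2 t : (T2 <= t)%N -> enorm (x t - z) < e ->
    r t `^ nu <= 2 * c * enorm (grad F (x t)) + q * a t.+1.
  by move=> Tt xt; have [_ h] := kl t (T2T1 _ Tt) xt; exact: h (r02 _ Tt).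
have p01 : 0 < 1 - nu < 1 by lra.
have [||A [B [A0 B0 wdec]]] := @local_length _ _ F x alpha beta gamma (N%:R / 2) M
  A1 A2 l c q (1 - nu) e T2 z a0 b0 g0 c00 A10 A20 c_gt0 q0 p01 (T20 _ (leqnn _))
  _ r02 dec2.
- by move=> t /T2T; exact: len.
- by move=> t Tt xt; rewrite subKr; exact: kl2.
set w := fun t => A * _ + _ in wdec.
have g21 : 0 < 2 * gamma - 1 by lra.
have w0 t : (T2 <= t)%N -> 0 <= w t.
  by move=> _; rewrite /w addr_ge0 ?mulr_ge0 ?powR_ge0.
have wcvg e1 : 0 < e1 -> exists T', forall t, (T' <= t)%N -> w t < e1.
  move=> e10; pose d := e1 / (A + B + 1).
  have d0 : 0 < d by rewrite divr_gt0//; lra.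
  have [T3 hT3] := rcvg _ (powR_gt0 (1 - nu)^-1 d0).
  have [T4 hT4] := powR_tail_lt b0 g21 d0.
  exists (maxn T2 (maxn T3 T4)) => t; rewrite !geq_max => /and3P[Tt T3t T4t].
  have h1 := powR_lt_small (r02 t _) p0 d0 (hT3 _ T3t).
  have {}h1 : r t `^ (1 - nu) < d.
    by apply: h1; rewrite !geq_max.
  have h2 := hT4 _ T4t.
  have : d * (A + B + 1) = e1 by rewrite divfK// gt_eqF//; lra.
  have := ler_wpM2l A0 (ltW h1); have := ler_wpM2l B0 (ltW h2).
  by rewrite /w; lra.
have [xz [T3 xw]] := trapped_cvg w0 wcvg near_z e0 wdec.
(* Convergence now places the whole tail of the path in the KL neighbourhood, so the scalar
   recursions hold for all large [t]. *)
split=> //; have [T4 xe] := (cvg_enormP _ _).1 xz _ e0.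
pose T5 := maxn T2 (maxn T3 T4).
have T52 t : (T5 <= t)%N -> (T2 <= t)%N by rewrite !geq_max => /and3P[].
have T53 t : (T5 <= t)%N -> (T3 <= t)%N by rewrite !geq_max => /and3P[].
have T54 t : (T5 <= t)%N -> (T4 <= t)%N by rewrite !geq_max => /and3P[].
have T50 : (0 < T5)%N by exact: T20 (T52 _ (leqnn _)).
have r05 t : (T5 <= t)%N -> 0 <= r t by move=> /T52; exact: r02.
have dec5 t : (T5 <= t)%N ->
    N%:R / 2 * a t.+1 * enorm (grad F (x t)) ^+ 2 <= r t - r t.+1.
  by move=> /T52; exact: dec2.
have s1 t : (T5 <= t)%N -> 1 <= t%:R + beta.
  by move=> /T52/T20 t0; exact: shift_ge1.
have [gl1|ge1] := ltP gamma 1.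
  have g01 : 2^-1 < gamma < 1 by rewrite g0.
  have [|Q Q0 rQ] := sublinear_value_rate a0 b0 g01 c00 c_gt0 q0 nug T50 r05 dec5.
    by move=> t Tt; apply: kl2; [exact: T52|exact: xe (T54 _ Tt)].
  exists (A * Q `^ (1 - nu) + B), T5; rewrite rate_lt1// -/nu.
  have nug1 : gamma / (3 * gamma - 1) <= nu < 1 by rewrite nug.
  have /andP[rho0 rho1] := rate_exponent_le g01 nug1.
  apply: (rescaled_le b0 rho0 _ T50) => [|t Tt].
    by rewrite addr_ge0// mulr_ge0// powR_ge0.
  apply: le_trans (xw _ (T53 _ Tt)) _; rewrite /w [leRHS]mulrDl -[X in _ <= X + _]mulrA.
  apply: lerD; rewrite ler_wpM2l//.
    rewrite -mulNr powRrM -powRM ?powR_ge0//.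
    by apply: ge0_ler_powR; rewrite ?nnegrE ?r05 ?mulr_ge0 ?powR_ge0 ?rQ// ltW.
  by apply: ler_powR; rewrite ?s1// lerN2.
have {g1 ge1}gE : gamma = 1 by apply/eqP; rewrite eq_le g1.
(* In the remaining branch the rate is [0], and eventual closeness to [z] gives the bound. *)
rewrite gE rate_eq1; case: ifPn => [/and3P[_ th2 ha]|_]; last first.
  exists e, T5 => t Tt; rewrite powRr0 mul1r ltW//; exact: xe (T54 _ Tt).
(* For [gamma = 1] the threshold is [1/2], so every [theta <= 1/2] is raised to exactly [1/2]. *)
have nuE : nu = 2^-1.
  have g2 : gamma / (3 * gamma - 1) = 2^-1 by rewrite gE; field.
  by rewrite /nu g2; apply/max_idPr.
have M2 : 0 <= M * alpha ^+ 3 / 2.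
  by rewrite divr_ge0// mulr_ge0// exprn_ge0// ltW.
(* The condition [alpha > 8 c^2 / N], rewritten for [c0 = N / 2]: it yields the contraction constant
   [4] of [inverse_square_rate]. *)
have hc : 4 * c ^+ 2 < N%:R / 2 * alpha.
  by move: ha; rewrite ltr_pdivrMr//; lra.
have [|||Q Q0 rQ] := @linear_value_rate _ r (fun t => F (x t) - l)
  (fun t => enorm (grad F (x t))) alpha beta (N%:R / 2) c (M * alpha ^+ 3 / 2) T5
  a0 b0 c00 c_gt0 M2 hc (T23 _ (T52 _ (leqnn _))) r05.
- move=> t; rewrite /r /error_tail gE.
  have -> : 3 * 1 - 1 = 2 :> R by ring.
  by ring.
- by move=> t /dec5; rewrite /a gE.
- move=> t Tt; rewrite -nuE.
  by have [] := kl t (T2T1 _ (T52 _ Tt)) (xe _ (T54 _ Tt)).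
exists (A * Q `^ 2^-1 + B), T5; apply: (rescaled_le b0 ler01 _ T50) => [|t Tt].
  by rewrite addr_ge0// mulr_ge0// powR_ge0.
have s0 : 0 <= t%:R + beta by have := s1 _ Tt; lra.
apply: le_trans (xw _ (T53 _ Tt)) _; rewrite /w [leRHS]mulrDl -[X in _ <= X + _]mulrA nuE.
have -> : 1 - 2^-1 = 2^-1 :> R by field.
apply: lerD; rewrite ler_wpM2l//; last first.
  by rewrite gE mulr1 (_ : 2 - 1 = 1 :> R)//; ring.
have -> : (t%:R + beta) `^ (-1) = ((t%:R + beta) ^- 2) `^ 2^-1.
  by rewrite -(powR_invn 2 s0) -powRrM; congr (_ `^ _); field.
rewrite -powRM ?invr_ge0 ?exprn_ge0//.
apply: ge0_ler_powR; rewrite ?nnegrE ?r05 ?divr_ge0 ?exprn_ge0 ?rQ// ?invr_ge0//.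
Qed.

(** For [gamma <= 1] the step sizes dominate a harmonic series. If the gradients stayed above [d],
    then [r t + k * ln (s t)] would be nonincreasing, although [r] is nonnegative and the logarithm
    is unbounded. *)
Lemma descent_gradient_not_bounded_away (R : realType) (r D : nat -> R)
    (alpha beta gamma c0 d : R) (T : nat) :
  0 < alpha -> 0 <= beta -> gamma <= 1 -> 0 < c0 -> 0 < d ->
  (forall t, (T <= t)%N -> 0 <= r t) ->
  (forall t, (T <= t)%N ->
     c0 * step_size alpha beta gamma t.+1 * D t ^+ 2 <= r t - r t.+1) ->
  ~ (forall t, (T <= t)%N -> d <= D t).
Proof.
move=> a0 b0 g1 c00 d0 r0 dec Dd.
pose k := c0 * alpha * d ^+ 2; have k0 : 0 < k by rewrite !mulr_gt0.
pose s t := t.+1%:R + beta.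
have s1 t : 1 <= s t by exact: shift_ge1.
have inc t : (T <= t)%N -> r t.+1 + k * ln (s t.+1) <= r t + k * ln (s t).
  move=> Tt; have st := s1 t.
  have sS : s t.+1 = s t + 1 by rewrite /s -[t.+2%:R]natr1; lra.
  have h1 : ln (s t.+1) - ln (s t) <= (s t)^-1.
    rewrite -ln_div ?posrE; [|rewrite sS; lra|lra].
    have -> : s t.+1 / s t = 1 + (s t)^-1.
      by rewrite sS; field; rewrite gt_eqF//; lra.
    by apply: le_ln1Dx; have : 0 <= (s t)^-1; [rewrite invr_ge0|]; lra.
  have h2 : alpha / s t <= step_size alpha beta gamma t.+1.
    have st0 : 0 < s t by lra.
    rewrite /step_size -/(s t) ler_wpM2l ?(ltW a0)// lef_pV2 ?posrE ?powR_gt0//.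
    exact: ler1_powR.
  have h3 : k * (s t)^-1 <= c0 * step_size alpha beta gamma t.+1 * D t ^+ 2.
    have -> : k * (s t)^-1 = c0 * (alpha / s t) * d ^+ 2 by rewrite /k; ring.
    apply: ler_pM; rewrite ?sqr_ge0 ?mulr_ge0 ?(ltW c00) ?(ltW a0) ?invr_ge0//.
    - by lra.
    - by rewrite ler_wpM2l// ltW.
    - by rewrite ler_pXn2r ?nnegrE ?(ltW d0) ?Dd// (le_trans (ltW d0)) ?Dd.
  have := dec t Tt; have := ler_wpM2l (ltW k0) h1.
  by lra.
have bd m : k * ln (s (T + m)%N) <= r T + k * ln (s T).
  suff : r (T + m)%N + k * ln (s (T + m)%N) <= r T + k * ln (s T).
    by have := r0 (T + m)%N (leq_addr _ _); lra.
  elim: m => [|m IH]; first by rewrite addn0.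
  by rewrite addnS; apply: le_trans IH; exact: inc (leq_addr _ _).
pose b := (r T + k * ln (s T)) / k.
pose m := (Num.truncn (expR b)).+1.
have : b < ln (s (T + m)%N).
  rewrite -ltr_expR lnK ?posrE; last by have := s1 (T + m)%N; lra.
  apply: lt_le_trans (truncnS_gt _) _; rewrite /s ler_wpDr// ler_nat.
  by rewrite -/m leqW// leq_addl.
rewrite ltNge /b ler_pdivlMr// mulrC => /negP; apply; exact: bd.
Qed.

(** * Reshuffled proximal paths and measurability of the limit *)

Lemma has_lbound_average (R : realType) (n N : nat) (f : 'I_N -> 'rV[R]_n -> R) :
  (forall i, has_lbound (range (f i))) -> has_lbound (range (average f)).
Proof.
move=> /choice[m fm]; exists (N%:R^-1 * \sum_(i < N) m i) => _ [x _ <-].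
rewrite /average ler_wpM2l ?invr_ge0//; apply: ler_sum => i _.
by apply: fm; exists x.
Qed.

Lemma enorm_grad_bounded (R : realType) (n N : nat) (L B : R)
    (f : 'I_N -> 'rV[R]_n -> R) :
  0 <= L -> (forall i, grad_lipschitz L (f i)) ->
  exists G, forall i x, enorm x <= B -> enorm (grad (f i) x) <= G.
Proof.
move=> L0 lip; exists (\sum_(i < N) enorm (grad (f i) 0) + L * B) => i x xB.
rewrite -(subrK (grad (f i) 0) (grad (f i) x)).
apply: le_trans (ler_enormD _ _) _; rewrite addrC; apply: lerD.
  by rewrite (bigD1 i)//= lerDl sumr_ge0// => j _; exact: enorm_ge0.
by apply: le_trans (lip _ _ _) _; rewrite subr0 ler_wpM2l.
Qed.

Lemma reshuffled_prox_perturbed_descent (R : realType) (n N : nat)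
    (f : 'I_N -> 'rV[R]_n -> R) (L alpha beta gamma B : R) (x0 : 'rV[R]_n)
    (w : samples N) (x : nat -> 'rV[R]_n) :
  (0 < N)%N -> 0 < L -> (forall i z, differentiable (f i) z) ->
  (forall i, grad_lipschitz L (f i)) ->
  0 < alpha -> 0 <= beta -> 0 < gamma ->
  reshuffled_prox f (step_size alpha beta gamma) x0 w x ->
  (forall t, enorm (x t) <= B) ->
  exists M A2 T, [/\ 0 <= M, 0 <= A2, (0 < T)%N &
    perturbed_descent (average f) x (step_size alpha beta gamma)
      (N%:R / 2) M N%:R A2 T].
Proof.
move=> N0 L0 df lip a0 b0 g0 [_ prox] xB.
have NR : 0 < N%:R :> R by rewrite ltr0n.
have N1 : 1 <= N%:R :> R by rewrite ler1n.
have [G hG] := enorm_grad_bounded B (ltW L0) lip.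
have G0 : 0 <= G.
  by apply: le_trans (hG (Ordinal N0) _ (xB 0%N)); exact: enorm_ge0.
pose E := L * 2 ^+ N.+1 * G.
have E0 : 0 <= E by rewrite !mulr_ge0 ?exprn_ge0 ?(ltW L0).
(* Once [(t + beta)^(-gamma)] is below this threshold, [N a_t L <= 1/2], as the drift and decrease
   bounds require. *)
have d0 : 0 < (2 * N%:R * L * alpha)^-1 by rewrite invr_gt0 !mulr_gt0.
have [T hT] := powR_tail_lt b0 g0 d0.
exists (N%:R / 2 * E ^+ 2), (N%:R * E), T.+1; split=> //.
- by rewrite mulr_ge0 ?sqr_ge0// divr_ge0.
- by rewrite mulr_ge0.
have step t : (T < t)%N -> 0 < step_size alpha beta gamma t.+1 /\
    exists2 e, x t.+1 = x t - (N%:R * step_size alpha beta gamma t.+1) *: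
        (grad (average f) (x t) + e) &
      enorm e <= E * step_size alpha beta gamma t.+1 /\
      N%:R * step_size alpha beta gamma t.+1 * L <= 2^-1.
  move=> Tt; have at0 := step_size_gt0 gamma t a0 b0; split=> //.
  have haL : N%:R * step_size alpha beta gamma t.+1 * L <= 2^-1.
    have := ltW (hT t.+1 (leqW (ltnW Tt))); rewrite step_sizeE.
    move=> /(ler_wpM2l (ltW (mulr_gt0 (mulr_gt0 NR L0) a0))).
    have -> : N%:R * L * alpha * (2 * N%:R * L * alpha)^-1 = 2^-1.
      by field; rewrite !gt_eqF.
    by move=> h; apply: le_trans h; rewrite le_eqVlt; apply/orP; left; apply/eqP; ring.
  have aL : step_size alpha beta gamma t.+1 * L <= 2^-1.
    apply: le_trans haL; rewrite -mulrA ler_peMl// mulr_ge0// ltW//.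
  have [y [y0 ymin yN]] := prox t.
  have [e ye eE] := epoch_step N0 L0 at0 aL df lip (fun i => hG i _ (xB t)) y0 ymin.
  by exists e; rewrite ?yN.
have FL := grad_lipschitz_average N0 df lip.
have Fd z : differentiable (average f) z by exact: differentiable_average.
split=> t Tt; have [at0 [e xe [eE aL]]] := step t Tt.
  rewrite xe; set a := step_size _ _ _ _ in at0 eE aL *.
  have h0 : 0 <= N%:R * a by rewrite mulr_ge0// ltW.
  apply: le_trans (epoch_decrease _ _ (ltW L0) h0 aL Fd FL) _.
  have h1 : enorm e ^+ 2 <= (E * a) ^+ 2.
    by rewrite ler_pXn2r ?nnegrE ?enorm_ge0// mulr_ge0// ltW.
  have h2 : 0 <= N%:R * a / 2 by rewrite divr_ge0.
  by have := ler_wpM2l h2 h1; lra.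
rewrite {1}xe addrAC subrr add0r enormN enormZ.
set a := step_size _ _ _ _ in at0 eE aL *.
have h0 : 0 <= N%:R * a by rewrite mulr_ge0// ltW.
rewrite ger0_norm//.
have := ler_wpM2l h0 (ler_enormD (grad (average f) (x t)) e).
by have := ler_wpM2l h0 eE; lra.
Qed.

(** Continuity forces [F z = l] at any accumulation point, so the KL analysis applies there and
    makes it the limit. Were [grad F z] nonzero, its Lipschitz continuity would keep the gradients
    along the tail away from zero. *)
Lemma perturbed_descent_cvg (R : realType) (n N : nat) (F : 'rV[R]_n -> R)
    (x : nat -> 'rV[R]_n) (alpha beta gamma L M A2 B : R) (T : nat) :
  (0 < N)%N -> 0 < alpha -> 0 <= beta -> 2^-1 < gamma <= 1 ->
  0 <= L -> 0 <= M -> 0 <= A2 -> (0 < T)%N ->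
  (forall z, differentiable F z) -> grad_lipschitz L F ->
  has_lbound (range F) -> (forall t, enorm (x t) <= B) ->
  perturbed_descent F x (step_size alpha beta gamma) (N%:R / 2) M N%:R A2 T ->
  (forall z, accumulation_points x z ->
     exists c theta : R, KL_exponent F z c theta) ->
  exists z, [/\ x t @[t --> \oo] --> z, crit F z &
    forall c theta, KL_exponent F z c theta ->
      exists Q T', forall t, (T' <= t)%N ->
        t%:R `^ rate N alpha gamma theta c * enorm (x t - z) <= Q].
Proof.
move=> N0 a0 b0 g01 L0 M0 A20 T0 Fd FL Fm xB pd KL.
have /andP[g0 g1] := g01; have NR : 0 < N%:R :> R by rewrite ltr0n.
have c00 : 0 < N%:R / 2 :> R by lra.
have [l [r0 dec rcvg Fcvg]] :=
  perturbed_descent_energy a0 b0 g0 (ltW c00) M0 T0 Fm pd.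
have Fcont : continuous F by move=> z; exact: differentiable_continuous.
have [z zacc] := bounded_accumulation_point xB.
have [c [theta KLz]] := KL _ zacc; have [k [kinc kz]] := zacc.
have kle i : (i <= k i)%N.
  by elim: i => // i IH; apply: leq_ltn_trans IH _; exact: kinc.
have Fz : F z = l.
  have h1 : F (x (k i)) @[i --> \oo] --> F z by exact: continuous_cvg (Fcont z) kz.
  have h2 : F (x (k i)) @[i --> \oo] --> l.
    apply/cvgrPdist_lt => e /Fcvg[T' hT']; exists T' => // i T'i /=.
    by rewrite distrC hT'// (leq_trans T'i).
  exact: cvg_unique h1 h2.
have near_z e T' : 0 < e -> exists t, (T' <= t)%N /\ enorm (x t - z) < e.
  move=> e0; have [T1 hT1] := (cvg_enormP _ _).1 kz _ e0.
  exists (k (maxn T1 T')); rewrite (leq_trans _ (kle _)) ?leq_maxr//; split=> //.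
  by apply: hT1; rewrite leq_maxl.
(* Kept general in the KL pair: one pair proves convergence, whereas the rate is claimed for every
   admissible pair at the limit. *)
have conv c' theta' : KL_exponent F z c' theta' -> _ :=
  fun KL' => KL_convergence N0 a0 b0 g01 M0 (ltW NR) A20 (descent_length pd) r0 dec
    rcvg Fcvg KL' Fz near_z.
have [xz _] := conv _ _ KLz.
exists z; split=> //; last by move=> c' theta' /conv[].
apply: enorm_eq0; apply/eqP; apply: contraT => Dn0.
have D0 : 0 < enorm (grad F z) by rewrite lt_def Dn0 enorm_ge0.
have L1 : 0 < L + 1 by lra.
have d0 : 0 < enorm (grad F z) / 2 by lra.
have [T1 hT1] := (cvg_enormP _ _).1 xz _ (divr_gt0 d0 L1).
have := @descent_gradient_not_bounded_away _ _ (fun t => enorm (grad F (x t)))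
  alpha beta gamma  (N%:R / 2) _ (maxn T T1) a0 b0 g1 c00 d0
  (fun t Tt => r0 t (leq_trans (leq_maxl _ _) Tt))
  (fun t Tt => dec t (leq_trans (leq_maxl _ _) Tt)).
case=> t; rewrite geq_max => /andP[_ /hT1]; rewrite ltr_pdivlMr// => h1.
have h2 := FL z (x t); rewrite (enorm_distC z) in h2.
have := ler_enormD (grad F z - grad F (x t)) (grad F (x t)); rewrite subrK.
by have := enorm_ge0 (x t - z); lra.
Qed.

(** An open [U] is exhausted by the closed sets [V k] of points whose ball of radius [1 / (k + 1)]
    lies in [U]. On [E], the limit lies in [U] exactly when, for some [k], the sequence is
    eventually in [V k], which is a countable set operation. *)
Lemma measurable_limit d (T : measurableType d) (R : realType) (n : nat)
    (X : nat -> T -> 'rV[R]_n) (E : set T) (Y : T -> 'rV[R]_n) (y0 : 'rV[R]_n) :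
  (forall t, random_vector (X t)) -> measurable E ->
  (forall w, E w -> X t w @[t --> \oo] --> Y w) -> (forall w, ~ E w -> Y w = y0) ->
  random_vector Y.
Proof.
move=> mX mE XY Y0.
apply: (@measurability _ _ T (g_sigma_algebraType (@open 'rV[R]_n)) setT Y
  (@open 'rV[R]_n)) => // _ [U oU <-].
rewrite setTI.
pose V k : set 'rV[R]_n := [set v | forall u, ball v k.+1%:R^-1 u -> U u].
have Vclosed k : closed (V k).
  rewrite -[V k]setCK; apply: open_closedC.
  have -> : ~` V k = \bigcup_(u in ~` U) ball u k.+1%:R^-1.
    apply/seteqP; split=> v.
      move=> /existsNP[u /not_implyP[vu Uu]]; exists u => //; exact: ball_sym.
    by move=> [u Uu uv] /(_ u (ball_sym uv)).
  by apply: bigcup_open => u _; exact: ball_open.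
have mXV t k : measurable (X t @^-1` V k).
  rewrite -[X in measurable X]setTI; apply: mX => //.
  rewrite -[V k]setCK; apply: measurableC; apply: sub_sigma_algebra.
  exact: closed_openC.
have -> : Y @^-1` U = (E `&` \bigcup_k \bigcup_m \bigcap_(t in [set t | (m <= t)%N])
    (X t @^-1` V k)) `|` (~` E `&` [set w | U y0]).
  apply/seteqP; split=> [w Uw|w].
    have [Ew|nEw] := pselect (E w); last by right; split=> //=; rewrite -(Y0 _ nEw).
    left; split=> //.
    have /nbhs_ballP[e /= e0 eU] : nbhs (Y w) U by exact: open_nbhs_nbhs.
    have [k ke] : exists k : nat, k.+1%:R^-1 <= e / 2.
      have e2 : 0 < e / 2 by rewrite divr_gt0.
      exists (Num.truncn (e / 2)^-1).
      by rewrite invf_ple ?posrE ?ltr0n// ltW// truncnS_gt.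
    have /cvg_ballP/(_ k.+1%:R^-1) := XY _ Ew; rewrite invr_gt0 ltr0n => /(_ isT)[m _ hm].
    exists k => //; exists m => // t mt u /= Xu; apply: eU.
    apply: (@le_ball _ _ _ (k.+1%:R^-1 + k.+1%:R^-1)).
      by rewrite [leRHS]splitr; exact: lerD.
    by apply: ball_triangle Xu; exact: hm.
  move=> [[Ew [k _ [m _ hm]]]|[nEw Uy0]]; last by rewrite /= (Y0 _ nEw).
  have /cvg_ballP/(_ k.+1%:R^-1) := XY _ Ew; rewrite invr_gt0 ltr0n => /(_ isT)[m' _ hm'].
  apply: (hm (maxn m m') (leq_maxl _ _)).
  by apply: ball_sym; exact: hm' (leq_maxr _ _).
apply: measurableU; apply: measurableI => //.
- apply: bigcup_measurable => k _; apply: bigcup_measurable => m _.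
  by apply: bigcap_measurable => [|t _]; [exists m => /=|].
- exact: measurableC.
- have [Uy|nUy] := pselect (U y0).
    by rewrite (_ : [set _ | _] = setT)//; apply/seteqP; split.
  by rewrite (_ : [set _ | _] = set0)//; apply/seteqP; split.
Qed.

Lemma probability_setI1 d (T : measurableType d) (R : realType)
    (P : probability T R) (A B : set T) :
  measurable A -> measurable B -> P A = 1%E -> P B = 1%E -> P (A `&` B) = 1%E.
Proof.
move=> mA mB PA PB; have mAB : measurable (A `&` B) by exact: measurableI.
rewrite -[A `&` B]setCK probability_setC; last exact: measurableC.
suff -> : P (~` (A `&` B)) = 0%E by rewrite sube0.
apply/eqP; rewrite eq_le measure_ge0 andbT setCI.
apply: (@le_trans _ _ (P (~` A) + P (~` B))%E).
  by apply: measureU2; exact: measurableC.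
by rewrite !probability_setC// PA PB subee// adde0.
Qed.

Lemma limn_esup_lty (R : realType) (u : nat -> R) (Q : R) (T : nat) :
  (forall t, (T <= t)%N -> u t <= Q) ->
  (limn_esup (fun t => (u t)%:E) < +oo)%E.
Proof.
move=> uQ; apply: (@le_lt_trans _ _ Q%:E); last exact: ltry.
rewrite limn_esup_lim; apply: lime_le; first exact: is_cvg_esups.
exists T => // m Tm /=; apply: ub_ereal_sup => _ [t mt <-].
by rewrite lee_fin uQ// (leq_trans Tm).
Qed.

(** * From individual paths to almost sure convergence *)

Theorem corollary4p2 (R : realType) (n N : nat) (hN : (0 < N)%N)
  (f : 'I_N -> 'rV[R]_n -> R) (L : R) (hL : 0 < L)
  (f_C1 : forall i, continuously_differentiable (f i))
  (f_bounded_below : forall i, has_lbound (range (f i)))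
  (f_lipschitz : forall i, grad_lipschitz L (f i))
  (P : probability (sample_space N) R) (hP : iid_uniform P)
  (alpha beta gamma : R) (halpha : 0 < alpha) (hbeta : 0 <= beta)
  (hgamma : 2^-1 < gamma <= 1)
  (x0 : 'rV[R]_n) (X : nat -> sample_space N -> 'rV[R]_n)
  (X_measurable : forall t, random_vector (X t))
  (X_prox : forall w,
     reshuffled_prox f (step_size alpha beta gamma) x0 w (fun t => X t w))
  (X_bounded : almost_surely P
     [set w | (ereal_sup [set (enorm (X t w))%:E | t in [set t | (1 <= t)%N]]
                 < +oo)%E])
  (K : set (sample_space N)) (K_measurable : measurable K)
  (PK : P K = 1%E)
  (f_KL : forall w, K w ->
     forall z, accumulation_points (fun t => X t w) z ->
       exists c theta : R, KL_exponent (average f) z c theta) :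
  exists Xs : sample_space N -> 'rV[R]_n,
    [/\ random_vector Xs,
        forall w, crit (average f) (Xs w),
        almost_surely P [set w | X t w @[t --> \oo] --> Xs w]
      & forall Theta C : sample_space N -> R,
          (forall w, K w -> X t w @[t --> \oo] --> Xs w ->
             KL_exponent (average f) (Xs w) (C w) (Theta w)) ->
          almost_surely P
            [set w | (limn_esup (fun t =>
               (t%:R `^ rate N alpha gamma (Theta w) (C w) *
                enorm (X t w - Xs w))%:E) < +oo)%E]].
Proof.
have [E [mE PE Ebd]] := X_bounded.
have df i z : differentiable (f i) z by have [] := f_C1 i.
pose H := E `&` K.
have mH : measurable H by exact: measurableI.
have PH : P H = 1%E by exact: probability_setI1.
have path w : H w -> exists z, [/\ X t w @[t --> \oo] --> z, crit (average f) z &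
    forall c theta, KL_exponent (average f) z c theta ->
      exists Q T', forall t, (T' <= t)%N ->
        t%:R `^ rate N alpha gamma theta c * enorm (X t w - z) <= Q].
  move=> [Ew Kw].
  have [B XB] : exists B, forall t, enorm (X t w) <= B.
    have := Ebd _ Ew; rewrite /=; set S := ereal_sup _ => Soo.
    (* The supremum [S] runs over [t >= 1] only, so the starting point is added by hand. *)
    exists (Num.max (enorm (X 0%N w)) (fine S)) => -[|t].
      by rewrite le_max lexx.
    have h : ((enorm (X t.+1 w))%:E <= S)%E by apply: ereal_sup_ubound; exists t.+1.
    rewrite le_max; apply/orP; right.
    have Sfin : S \is a fin_num.
      by rewrite fin_numE -ltey Soo andbT gt_eqF// (lt_le_trans _ h)// ltNyr.
    by rewrite -lee_fin fineK.
  have g0 : 0 < gamma by case/andP: hgamma; lra.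
  have [M [A2 [T [M0 A20 T0 pd]]]] := reshuffled_prox_perturbed_descent hN hL df
    f_lipschitz halpha hbeta g0 (X_prox w) XB.
  apply: (perturbed_descent_cvg hN halpha hbeta hgamma (ltW hL) M0 A20 T0 _ _ _ XB pd).
  - by move=> z; exact: differentiable_average.
  - exact: grad_lipschitz_average.
  - exact: has_lbound_average.
  - exact: f_KL.
(* An event of probability one is nonempty, which supplies a critical point [y0]. As default value
   off [H] it keeps [Xs] measurable and critical for every sample. *)
have [w0 Hw0] : H !=set0.
  apply/set0P/eqP => H0; move: PH; rewrite H0 measure0 => /eqP.
  by rewrite eq_sym onee_eq0.
have [y0 [_ y0crit _]] := path _ Hw0.
have /choice[Xs hXs] w : exists z, (H w -> [/\ X t w @[t --> \oo] --> z,
    crit (average f) z & forall c theta, KL_exponent (average f) z c theta ->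
      exists Q T', forall t, (T' <= t)%N ->
        t%:R `^ rate N alpha gamma theta c * enorm (X t w - z) <= Q]) /\
    (~ H w -> z = y0).
  have [Hw|nHw] := pselect (H w); last by exists y0.
  by have [z hz] := path _ Hw; exists z.
exists Xs; split.
- apply: (measurable_limit X_measurable mH) => w Hw; last exact: (hXs w).2.
  by case: ((hXs w).1 Hw).
- move=> w; have [Hw|nHw] := pselect (H w); first by case: ((hXs w).1 Hw).
  by rewrite ((hXs w).2 nHw).
- by exists H; split=> // w Hw; case: ((hXs w).1 Hw).
- move=> Theta C KL; exists H; split=> // w Hw /=.
  have [Xw _ hrate] := (hXs w).1 Hw.
  have [Q [T' hQ]] := hrate _ _ (KL w Hw.2 Xw).
  exact: limn_esup_lty hQ.
Qed.
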